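(* Let $c$ be a good cost that is continuous on $\mathbb R^2$, let $F,G$ be continuous and strictly increasing, and suppose that $0\le c(x,y)\le V(x)+V(y)$ for all $x,y$, where $V$ is a strictly increasing function such that $\mathbb E\,V(X)<+\infty$ and $\mathbb E\,V(Y)<+\infty$ for $X\sim F$, $Y\sim G$. Then $$\lim_{n\to\infty}W_c(\mathbb F_n,\mathbb G_n)=W_c(F,G)<+\infty\quad\text{almost surely.}$$
   Context: $F,G$ are c.d.f.s on $\mathbb R$. A good cost is a function $c:\mathbb R^2\to\mathbb R$ defining a negative measure on $\mathbb R^2$, i.e. $c(x',y')-c(x',y)-c(x,y')+c(x,y)\le 0$ for all $x\le x'$, $y\le y'$. The Wasserstein cost is $W_c(F,G)=\min_{X\sim F,\,Y\sim G}\mathbb E\,c(X,Y)$; for a good cost it equals $\int_0^1c(F^{-1}(u),G^{-1}(u))\,du$, where $F^{-1},G^{-1}$ are generalized inverses. $(X_i,Y_i)_{i\ge1}$ are i.i.d. random vectors with an arbitrary common law $\Pi$ on $\mathbb R^2$ having marginal c.d.f.s $F$ and $G$ (the two coordinates may be dependent). $\mathbb F_n,\mathbb G_n$ are the empirical c.d.f.s of $(X_i)_{i\le n}$ and $(Y_i)_{i\le n}$, so that $W_c(\mathbb F_n,\mathbb G_n)=\frac1n\sum_{i=1}^nc(X_{(i)},Y_{(i)})$, with $X_{(1)}\le\dots\le X_{(n)}$ and $Y_{(1)}\le\dots\le Y_{(n)}$ the order statistics. *)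

(* Defs.v *)
From HB Require Import structures.
From mathcomp Require Export all_boot all_order all_algebra finmap.
From mathcomp Require Export all_classical all_reals all_analysis.

Set Implicit Arguments.
Unset Strict Implicit.
Unset Printing Implicit Defensive.

Import Order.TTheory GRing.Theory Num.Theory.
Import numFieldNormedType.Exports.

Local Open Scope classical_set_scope.
Local Open Scope ring_scope.

(* Nonpositive rectangle increments (c "defines a negative measure"); no
   regularity of c is included. *)
Definition good_cost (R : realType) (c : R -> R -> R) : Prop :=
  forall x x' y y' : R, x <= x' -> y <= y' ->
    c x' y' - c x' y - c x y' + c x y <= 0.

(* X ~ F for a finite-valued F; the library's [cdf] takes values in \bar R. *)
Definition has_cdf (R : realType) (d : measure_display) (T : measurableType d)
    (P : probability T R) (X : {RV P >-> R}) (F : R -> R) : Prop :=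
  forall r : R, cdf X r = (F r)%:E.

(* Infimum of E c(X, Y) over all pairs of random variables defined on a common,
   arbitrary, probability space with X ~ F and Y ~ G. It is +oo if F or G is
   not a c.d.f. (there is no coupling). Only meant for measurable costs c such
   that c(X, Y) has an expectation, e.g. c nonnegative. *)
Definition wasserstein_cost (R : realType) (c : R -> R -> R) (F G : R -> R) :
    \bar R :=
  ereal_inf [set e : \bar R |
    exists (d : measure_display) (T : measurableType d) (P : probability T R)
           (X Y : {RV P >-> R}),
      [/\ has_cdf X F, has_cdf Y G & e = 'E_P[fun t => c (X t) (Y t)]%E]].

(* Empirical c.d.f. of the n points x 0, ..., x (n - 1); it is identically 0
   when n = 0, hence not a c.d.f. in that case. *)
Definition empirical_cdf (R : realType) (x : nat -> R) (n : nat) : R -> R :=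
  fun r => (\sum_(i < n) (x i <= r)%R%:R) / n%:R.

(* The Z i are mutually independent (product rule over every finite set of
   indices) with common law Pi. *)
Definition iid_with_law (R : realType) (d d' : measure_display)
    (T : measurableType d) (S : measurableType d') (P : probability T R)
    (Z : nat -> {RV P >-> S}) (Pi : probability S R) : Prop :=
  (forall (i : nat) (A : set S), measurable A -> distribution P (Z i) A = Pi A)
  /\
  (forall (J : {fset nat}) (A : nat -> set S), (forall i, measurable (A i)) ->
     P (\bigcap_(i in [set` J]) (Z i @^-1` A i))
     = (\prod_(i <- J) P (Z i @^-1` A i))%E).

Definition marginal_cdfs (R : realType) (Pi : probability (R * R)%type R)
    (F G : R -> R) : Prop :=
  (forall r : R, Pi (`]-oo, r] `*` setT) = (F r)%:E) /\
  (forall r : R, Pi (setT `*` `]-oo, r]) = (G r)%:E).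

(* Main.v *)
From HB Require Import structures.
Require Import Defs.
From mathcomp Require Import all_boot all_order all_algebra finmap.
From mathcomp Require Import all_classical all_reals all_analysis.
From mathcomp Require Import measurable_realfun ring lra.

(* On a finite grid a_0 < ... < a_N, rounding down turns a good cost into the
   finite sum of D_ij 1{x > a_i} 1{y > a_j}, with D_ij <= 0 as soon as
   i, j >= 1. Its expectation under a coupling of F and G is therefore at least
   the number I(F, G) obtained by replacing P(X > a_i, Y > a_j) with
   min(1 - F(a_i), 1 - G(a_j)), with equality for the quantile coupling. As c
   is uniformly continuous on squares and dominated by V outside, rounding
   costs at most e + 2 E[tau(X) + tau(Y)] for every coupling, where tau lives
   outside a large interval; hence |W_c(F, G) - I(F, G)| has the same bound,
   both for (F, G) and for the empirical pair. I depends continuously on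
   finitely many values of the two c.d.f.s, so the theorem reduces to the law
   of large numbers for indicators and to a one-sided one,
   limsup (1/n) sum_i tau(X_i) <= E tau(X), for the nonnegative integrable tau.
   The latter holds by truncation, Chebyshev and Borel-Cantelli along the
   sequences N 2^k, and monotonicity in n in between. *)

Set Implicit Arguments.
Unset Strict Implicit.
Unset Printing Implicit Defensive.

Import Order.TTheory GRing.Theory Num.Theory.
Import numFieldNormedType.Exports.

Local Open Scope classical_set_scope.
Local Open Scope ring_scope.

(** * A one-sided law of large numbers *)

Section IidPairs.
Context (R : realType) (d d' : measure_display) (T : measurableType d)
  (S : measurableType d') (P : probability T R) (Pi : probability S R)
  (Z : nat -> {RV P >-> S}) (Z_iid : iid_with_law Z Pi).

Lemma iid_integral (f : S -> \bar R) (i : nat) :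
  measurable_fun setT f -> (forall z, 0 <= f z)%E ->
  (\int[P]_t f (Z i t) = \int[Pi]_z f z)%E.
Proof.
move=> mf f0; rewrite -(ge0_integral_distribution (Z i) mf f0).
by apply: eq_measure_integral => A mA _; apply Z_iid.1.
Qed.

Lemma iid_pair_law (i j : nat) (A B : set S) : i != j ->
  measurable A -> measurable B ->
  P (Z i @^-1` A `&` Z j @^-1` B) = (Pi A * Pi B)%E.
Proof.
move=> ij mA mB; have ji : (j == i) = false by rewrite eq_sym (negbTE ij).
have law k C : measurable C -> P (Z k @^-1` C) = Pi C by exact: Z_iid.1.
pose C k := if k == i then A else B.
have mC k : measurable (C k) by rewrite /C; case: ifP.
have := Z_iid.2 [fset i; j]%fset C mC.
rewrite big_fsetU1 ?inE//= big_seq_fset1 !law// /C eqxx ji => <-.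
congr (P _); apply/seteqP; split => [t [At Bt] k /=|t H].
  by rewrite !inE => /orP[/eqP ->|/eqP ->]; rewrite ?eqxx ?ji.
split.
  by have := H i; rewrite /= !inE eqxx /= => /(_ isT).
by have := H j; rewrite /= !inE eqxx orbT ji => /(_ isT).
Qed.

(** The law of [(Z i, Z j)] agrees with the product measure on rectangles, hence everywhere; Tonelli
    then factors the integral. *)
Lemma iid_pair_integral (h : S -> R) (m : R) (i j : nat) : i != j ->
  measurable_fun setT h -> (forall z, 0 <= h z) ->
  (\int[Pi]_z (h z)%:E = m%:E)%E ->
  (\int[P]_t (h (Z i t) * h (Z j t))%:E = (m * m)%:E)%E.
Proof.
move=> ij mh h0 hm.
have mphi : measurable_fun setT (fun t => (Z i t, Z j t)).
  by apply: measurable_fun_pair.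
pose k (z : S * S) := (h z.1 * h z.2)%:E.
have mk : measurable_fun setT k.
  by apply/measurable_EFinP; apply: measurable_funM; apply: measurableT_comp.
have k0 z : (0 <= k z)%E by rewrite lee_fin mulr_ge0.
transitivity (\int[pushforward P (fun t => (Z i t, Z j t))]_z k z)%E.
  by rewrite ge0_integral_pushforward// preimage_setT.
transitivity (\int[(Pi \x Pi)%E]_z k z)%E.
  apply: eq_measure_integral => A mA _; apply/esym.
  pose mu := [the measure _ _ of pushforward P (fun t => (Z i t, Z j t))].
  refine (@product_measure_unique _ _ _ _ _ Pi Pi (mu mphi) _ A mA) => B C mB mC.
  exact: iid_pair_law ij mB mC.
have mhE : measurable_fun setT (fun z => (h z)%:E) by exact/measurable_EFinP.
have h0E z : setT z -> (0 <= (h z)%:E)%E by rewrite lee_fin.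
have m0 : (0 <= m%:E)%E by rewrite -hm integral_ge0.
rewrite fubini_tonelli1// /fubini_F/=.
transitivity (\int[Pi]_x (m%:E * (h x)%:E))%E.
  apply: eq_integral => x _; under eq_integral do rewrite /k/= EFinM.
  by rewrite (ge0_integralZl _ _ mhE h0E) ?lee_fin// muleC; congr (_ * _)%E.
by rewrite (ge0_integralZl _ _ mhE h0E)// hm EFinM.
Qed.

End IidPairs.

(** * Moments and deviations of truncated sums *)

Section TruncatedDeviation.
Context (R : realType) (d d' : measure_display) (T : measurableType d)
  (S : measurableType d') (P : probability T R) (Pi : probability S R)
  (Z : nat -> {RV P >-> S}) (Z_iid : iid_with_law Z Pi).

Lemma measurable_sum_gt (f : S -> R) (n : nat) (a : R) :
  measurable_fun setT f ->
  measurable [set t | a < \sum_(i < n) f (Z i t)].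
Proof.
move=> mf; set B := [set t | _].
have -> : B = setT `&` (fun t => \sum_(i < n) f (Z i t)) @^-1` `]a, +oo[%classic.
  by rewrite setTI; apply/seteqP; split => t; rewrite /B/= in_itv/= andbT.
apply: (measurable_sum (I := 'I_n)) => // i.
exact: measurableT_comp.
Qed.

(** Expand the square: each of the n diagonal terms contributes s, each off-diagonal term m^2 by
    independence. *)
Lemma iid_second_moment (h : S -> R) (m s : R) (n : nat) :
  measurable_fun setT h -> (forall z, 0 <= h z) ->
  (\int[Pi]_z (h z)%:E = m%:E)%E -> (\int[Pi]_z (h z ^+ 2)%:E = s%:E)%E ->
  (\int[P]_t ((\sum_(i < n) h (Z i t)) ^+ 2)%:E
   <= (n%:R * s + (n%:R * m) ^+ 2)%:E)%E.
Proof.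
move=> mh h0 hm hs.
have mhZ i : measurable_fun setT (fun t => h (Z i t)) by exact: measurableT_comp.
have mhh i j : measurable_fun setT (fun t => (h (Z i t) * h (Z j t))%:E).
  by apply/measurable_EFinP; exact: measurable_funM.
have hh0 i j t : (0 <= (h (Z i t) * h (Z j t))%:E)%E by rewrite lee_fin mulr_ge0.
have s0 : 0 <= s by rewrite -lee_fin -hs integral_ge0// => z _; rewrite lee_fin sqr_ge0.
under eq_integral do rewrite expr2 mulr_suml -sumEFin.
rewrite ge0_integral_sum//; last 2 first.
- move=> i; apply/measurable_EFinP; apply: measurable_funM => //.
  exact: measurable_sum.
- by move=> i t _; rewrite lee_fin mulr_ge0// sumr_ge0.
(* The bound becomes a double sum, to be compared term by term; the m^2 on the diagonal is slack. *)
have -> : n%:R * s + (n%:R * m) ^+ 2 =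
    \sum_(i < n) \sum_(j < n) ((i == j)%:R * s + m ^+ 2).
  under eq_bigr do rewrite big_split/= sumr_const card_ord.
  rewrite big_split/= sumr_const card_ord.
  under eq_bigr do rewrite -mulr_suml.
  rewrite -mulr_suml; congr (_ * _ + _); last first.
    by rewrite -mulrnA -[RHS]mulr_natl natrM; ring.
  under eq_bigr => i _.
    rewrite (bigD1 i)//= eqxx big1 ?addr0; last first.
      by move=> j /negbTE; rewrite eq_sym => ->.
    over.
  by rewrite sumr_const card_ord.
rewrite -sumEFin; apply: lee_sum => i _.
under eq_integral do rewrite mulr_sumr -sumEFin.
rewrite ge0_integral_sum//.
rewrite -sumEFin; apply: lee_sum => j _.
have [<-|ij] := eqVneq i j.
  rewrite mul1r; under eq_integral do rewrite -expr2.
  rewrite (iid_integral Z_iid (f := fun z => (h z ^+ 2)%:E)) ?hs.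
  - by rewrite lee_fin lerDl sqr_ge0.
  - by apply/measurable_EFinP; exact: measurable_funX.
  - by move=> z; rewrite lee_fin sqr_ge0.
by rewrite mul0r add0r (iid_pair_integral Z_iid ij mh h0 hm) expr2.
Qed.

(** The truncation level is the sample size. With h = min(f, n), Chebyshev for the sum of the h(Z_i)
    costs eps^-2 E h^2 / n, and the event that some f(Z_i) exceeds n costs at most n P(f > n) <= E
    h^2 / n; hence the factor 1 + eps^-2. *)
Lemma truncated_deviation (f : S -> R) (m eps : R) (n : nat) :
  (0 < n)%N -> 0 < eps -> measurable_fun setT f -> (forall z, 0 <= f z) ->
  (\int[Pi]_z (f z)%:E = m%:E)%E ->
  (P [set t | (n%:R * (m + eps) < \sum_(i < n) f (Z i t))%R] <=
   ((1 + eps ^- 2))%:E *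
    \int[Pi]_z (Num.min (f z) n%:R ^+ 2 / n%:R)%:E)%E.
Proof.
move=> n0 e0 mf f0 fm; pose h z := Num.min (f z) n%:R.
have nR0 : 0 < n%:R :> R by rewrite ltr0n.
have mh : measurable_fun setT h by exact: measurable_minr.
have h0 z : 0 <= h z by rewrite le_min f0 ltW.
have hn z : h z <= n%:R by rewrite ge_min lexx orbT.
have mhE : measurable_fun setT (fun z => (h z)%:E) by exact/measurable_EFinP.
have mh2E : measurable_fun setT (fun z => (h z ^+ 2)%:E).
  by apply/measurable_EFinP; exact: measurable_funX.
have m0 : 0 <= m by rewrite -lee_fin -fm integral_ge0// => z _; rewrite lee_fin.
have hlem : (\int[Pi]_z (h z)%:E <= m%:E)%E.
  rewrite -fm; apply: ge0_le_integral => //.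
  - by move=> z _; rewrite lee_fin.
  - exact/measurable_EFinP.
  - by move=> z _; rewrite lee_fin ge_min lexx.
have [m' hm'] : exists m', (\int[Pi]_z (h z)%:E = m'%:E)%E.
  exists (fine (\int[Pi]_z (h z)%:E)%E); rewrite fineK// ge0_fin_numE.
    exact: le_lt_trans hlem (ltry _).
  by apply: integral_ge0 => z _; rewrite lee_fin.
(* Truncation lowers the mean, so exceeding m + eps entails exceeding m' + eps. *)
have m'm : m' <= m by rewrite -lee_fin -hm'.
have m'0 : 0 <= m' by rewrite -lee_fin -hm' integral_ge0// => z _; rewrite lee_fin.
have [s hs] : exists s, (\int[Pi]_z (h z ^+ 2)%:E = s%:E)%E.
  exists (fine (\int[Pi]_z (h z ^+ 2)%:E)%E); rewrite fineK// ge0_fin_numE.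
    apply: (@le_lt_trans _ _ (\int[Pi]_z (cst (n%:R ^+ 2)%:E z))%E).
      apply: ge0_le_integral => //.
      - by move=> z _; rewrite lee_fin sqr_ge0.
      - by move=> z _; rewrite lee_fin lerXn2r ?nnegrE ?h0 ?(ltW nR0) ?hn.
    by rewrite integral_cst//= probability_setT mule1 ltry.
  by apply: integral_ge0 => z _; rewrite lee_fin sqr_ge0.
have s0 : 0 <= s by rewrite -lee_fin -hs integral_ge0// => z _; rewrite lee_fin sqr_ge0.
set B := [set t | _].
have mhZ i : measurable_fun setT (fun t => h (Z i t)) by exact: measurableT_comp.
have mB : measurable B by exact: measurable_sum_gt.
have mS : measurable_fun setT (fun t => \sum_(i < n) h (Z i t)).
  exact: measurable_sum.
have S0 t : 0 <= \sum_(i < n) h (Z i t) by apply: sumr_ge0.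
(* On B either every f (Z i t) is at most n, and then the truncated sum exceeds
   its mean by n eps, or some squared truncation is n ^ 2; the cross term of
   the square is moved to the left to integrate nonnegative functions only. *)
have pw t : n%:R ^+ 2 * eps ^+ 2 * \1_B t + 2 * n%:R * m' * \sum_(i < n) h (Z i t)
    <= (\sum_(i < n) h (Z i t)) ^+ 2 + (n%:R ^+ 2 * m' ^+ 2 +
       eps ^+ 2 * \sum_(i < n) h (Z i t) ^+ 2).
  set x := \sum_(i < n) h (Z i t); set y := \sum_(i < n) _ ^+ 2.
  have y0 : 0 <= y by apply: sumr_ge0 => i _; rewrite sqr_ge0.
  have sq0 : 0 <= (x - n%:R * m') ^+ 2 by exact: sqr_ge0.
  have ey0 : 0 <= eps ^+ 2 * y by rewrite mulr_ge0// sqr_ge0.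
  rewrite indicE; have [tB|_] := boolP (t \in B); last first.
    by rewrite mulr0 add0r; nra.
  rewrite inE /B/= in tB; rewrite mulr1.
  have [/forallP fle|] := boolP [forall i : 'I_n, f (Z i t) <= n%:R].
    have xE : x = \sum_(i < n) f (Z i t).
      by apply: eq_bigr => i _; rewrite /h; apply/min_idPl.
    rewrite -xE in tB.
    have nm : n%:R * m' <= n%:R * m by rewrite ler_pM2l.
    have : (n%:R * eps) ^+ 2 <= (x - n%:R * m') ^+ 2.
      have ne0 : 0 <= n%:R * eps by rewrite mulr_ge0 ?ltW.
      by rewrite lerXn2r ?nnegrE//; lra.
    by lra.
  move=> /forallPn[i]; rewrite -ltNge => ni.
  have ny : n%:R ^+ 2 <= y.
    rewrite /y (bigD1 i)//= /h (min_idPr (ltW ni)) lerDl sumr_ge0// => j _.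
    by rewrite sqr_ge0.
  have : eps ^+ 2 * n%:R ^+ 2 <= eps ^+ 2 * y by rewrite ler_pM2l ?exprn_gt0.
  by move: sq0; rewrite sqrrB; lra.
have ne0 : 0 <= n%:R ^+ 2 * eps ^+ 2 by rewrite mulr_ge0 ?sqr_ge0.
have nm0 : 0 <= 2 * n%:R * m' by rewrite mulr_ge0// mulr_ge0// ltW.
have mSE : measurable_fun setT (fun t => (\sum_(i < n) h (Z i t))%:E).
  exact/measurable_EFinP.
have mS2E : measurable_fun setT (fun t => ((\sum_(i < n) h (Z i t)) ^+ 2)%:E).
  by apply/measurable_EFinP; exact: measurable_funX.
have mBE : measurable_fun setT (fun t => (\1_B t)%:E : \bar R).
  by apply/measurable_EFinP; exact: measurable_indic.
have mh2Z (i : 'I_n) : measurable_fun setT (fun t => (h (Z i t) ^+ 2)%:E).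
  by apply/measurable_EFinP; exact: measurable_funX.
have mh2S : measurable_fun setT (fun t => \sum_(i < n) (h (Z i t) ^+ 2)%:E)%E.
  exact: emeasurable_sum.
have ES : (\int[P]_t (\sum_(i < n) h (Z i t))%:E = (n%:R * m')%:E)%E.
  under eq_integral do rewrite -sumEFin.
  rewrite ge0_integral_sum//; last 2 first.
  - by move=> i; exact/measurable_EFinP.
  - by move=> i t _; rewrite lee_fin.
  under eq_bigr do rewrite (iid_integral Z_iid (f := fun z => (h z)%:E))// hm'.
  by rewrite sumEFin sumr_const card_ord mulr_natl.
have ES2 : (\int[P]_t (\sum_(i < n) (h (Z i t) ^+ 2)%:E) = (n%:R * s)%:E)%E.
  rewrite ge0_integral_sum//; last first.
    by move=> i t _; rewrite lee_fin sqr_ge0.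
  have E2 (i : 'I_n) : (\int[P]_t (h (Z i t) ^+ 2)%:E = s%:E)%E.
    rewrite (iid_integral Z_iid (f := fun z => (h z ^+ 2)%:E)) ?hs// => z.
    by rewrite lee_fin sqr_ge0.
  by under eq_bigr do rewrite E2; rewrite sumEFin sumr_const card_ord mulr_natl.
have PBfin : P B \is a fin_num by rewrite fin_num_measure.
have : ((n%:R ^+ 2 * eps ^+ 2)%:E * P B + (2 * n%:R * m')%:E * (n%:R * m')%:E
    <= (n%:R * s + (n%:R * m') ^+ 2)%:E
       + ((n%:R ^+ 2 * m' ^+ 2)%:E + (eps ^+ 2)%:E * (n%:R * s)%:E))%E.
  rewrite -{1}ES -{1}(setIT B) -(integral_indic P measurableT mB).
  have g1 t : [set: T] t -> (0 <= (\1_B t)%:E :> \bar R)%E by rewrite lee_fin.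
  have g2 t : [set: T] t -> (0 <= (\sum_(i < n) h (Z i t))%:E :> \bar R)%E.
    by rewrite lee_fin.
  have g3 t : [set: T] t -> (0 <= \sum_(i < n) (h (Z i t) ^+ 2)%:E :> \bar R)%E.
    by move=> _; rewrite sume_ge0// => i _; rewrite lee_fin sqr_ge0.
  have g4 t : [set: T] t -> (0 <= ((\sum_(i < n) h (Z i t)) ^+ 2)%:E :> \bar R)%E.
    by rewrite lee_fin sqr_ge0.
  have c0 : (0 <= (n%:R ^+ 2 * m' ^+ 2)%:E :> \bar R)%E.
    by rewrite lee_fin mulr_ge0 ?sqr_ge0.
  have g5 t : [set: T] t -> (0 <= (n%:R ^+ 2 * m' ^+ 2)%:E + (eps ^+ 2)%:E *
      \sum_(i < n) (h (Z i t) ^+ 2)%:E :> \bar R)%E.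
    by move=> tT; rewrite adde_ge0// mule_ge0 ?lee_fin ?sqr_ge0 ?g3.
  rewrite -(ge0_integralZl_EFin _ _ g1)// -(ge0_integralZl_EFin _ _ g2)//.
  rewrite -ge0_integralD//; last 4 first.
  - by move=> t tT; rewrite mule_ge0 ?g1 ?lee_fin.
  - exact: measurable_funeM.
  - by move=> t tT; rewrite mule_ge0 ?g2 ?lee_fin.
  - exact: measurable_funeM.
  apply: (@le_trans _ _ (\int[P]_t (((\sum_(i < n) h (Z i t)) ^+ 2)%:E +
    ((n%:R ^+ 2 * m' ^+ 2)%:E + (eps ^+ 2)%:E *
      \sum_(i < n) (h (Z i t) ^+ 2)%:E)))%E).
    apply: ge0_le_integral => //.
    - by move=> t tT; rewrite adde_ge0// mule_ge0 ?g1 ?g2 ?lee_fin.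
    - by apply: emeasurable_funD; exact: measurable_funeM.
    - apply: emeasurable_funD => //; apply: emeasurable_funD => //.
      exact: measurable_funeM.
    - by move=> t _; rewrite sumEFin -!EFinM -!EFinD lee_fin.
  rewrite ge0_integralD//; last first.
    by apply: emeasurable_funD => //; exact: measurable_funeM.
  apply: leeD; first exact: iid_second_moment.
  rewrite ge0_integralD//; last 2 first.
  - by move=> t tT; rewrite mule_ge0 ?lee_fin ?sqr_ge0 ?g3.
  - exact: measurable_funeM.
  rewrite ge0_integralZl_EFin// ?sqr_ge0// ES2.
  by rewrite integral_cst//= probability_setT mule1.
have h2 z : [set: S] z -> (0 <= (h z ^+ 2)%:E :> \bar R)%E.
  by rewrite lee_fin sqr_ge0.
have -> : (\int[Pi]_z (Num.min (f z) n%:R ^+ 2 / n%:R)%:E = (n%:R^-1 * s)%:E)%E.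
  rewrite EFinM -hs.
  rewrite -(ge0_integralZl_EFin _ _ h2 mh2E) ?invr_ge0 ?ltW//.
  by apply: eq_integral => z _; rewrite -EFinM mulrC.
rewrite -(fineK PBfin) -!EFinM -!EFinD !lee_fin.
set p := fine (P B) => key.
(* The cross term 2 (n m')^2 on the left cancels the two squares (n m')^2 on the right. *)
have {}key : n%:R ^+ 2 * eps ^+ 2 * p <= n%:R * s * (1 + eps ^+ 2) by nra.
have -> : (1 + eps ^- 2) * (n%:R^-1 * s) =
    (n%:R * s * (1 + eps ^+ 2)) / (n%:R ^+ 2 * eps ^+ 2).
  by field; rewrite !gt_eqF.
by rewrite ler_pdivlMr ?mulr_gt0 ?exprn_gt0// mulrC.
Qed.

End TruncatedDeviation.

(** A level a 2^k below f contributes itself, a level above f contributes f^2 divided by the level;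
    both sums are geometric and governed by the levels closest to f. *)
Lemma dyadic_truncation_sum (R : realType) (f a : R) (K : nat) :
  0 <= f -> 0 < a ->
  \sum_(0 <= k < K) Num.min f (a * 2 ^+ k) ^+ 2 / (a * 2 ^+ k) <= 4 * f.
Proof.
(* Induction on [K] replaces b by 2 b, so the bound has to depend on b; 4 f - b reproduces itself,
   since b + (4 f - 2 b) = 4 f - b. *)
move=> f0; suff key b : 0 < b ->
    \sum_(0 <= k < K) Num.min f (b * 2 ^+ k) ^+ 2 / (b * 2 ^+ k) <=
    if f <= b then 2 * f ^+ 2 / b else 4 * f - b.
  move=> a0; apply: (le_trans (key a a0)).
  case: (leP f a) => fa; last by rewrite gerBl ltW.
  by rewrite ler_pdivrMr//; nra.
elim: K b => [|K IH] b b0.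
  rewrite big_nil; case: (leP f b) => fb; last by lra.
  by apply: divr_ge0; [apply: mulr_ge0 => //; exact: sqr_ge0|exact: ltW].
rewrite big_nat_recl// expr0 mulr1.
under eq_bigr do rewrite (exprS 2%R) mulrA.
have b20 : 0 < b * 2 by rewrite mulr_gt0.
have {}IH := IH (b * 2) b20.
apply: (le_trans (lerD (lexx _) IH)); case: (leP f b) => fb.
  have -> : f <= b * 2 by lra.
  have -> : 2 * f ^+ 2 / (b * 2) = f ^+ 2 / b by field; rewrite gt_eqF.
  by rewrite -mulrA; set x := _ / _; lra.
have -> : b ^+ 2 / b = b by field; rewrite gt_eqF.
case: (leP f (b * 2)) => fb2; last by lra.
have -> : 2 * f ^+ 2 / (b * 2) = f ^+ 2 / b by field; rewrite gt_eqF.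
have : f ^+ 2 / b <= 2 * f by rewrite ler_pdivrMr//; nra.
by lra.
Qed.

(** * From geometric sequences of sample sizes to all sample sizes *)

Section UpperLLN.
Context (R : realType) (d d' : measure_display) (T : measurableType d)
  (S : measurableType d') (P : probability T R) (Pi : probability S R)
  (Z : nat -> {RV P >-> S}) (Z_iid : iid_with_law Z Pi).

(** Over all n the sum of min(f, n)^2 / n diverges wherever f > 0, hence the geometric sequence:
    along N 2^k, Tonelli and [dyadic_truncation_sum] bound the sum of the probabilities by a
    multiple of E f, and Borel-Cantelli applies. *)
Lemma upper_lln_dyadic (f : S -> R) (m eps : R) (N : nat) :
  (0 < N)%N -> 0 < eps -> measurable_fun setT f -> (forall z, 0 <= f z) ->
  (\int[Pi]_z (f z)%:E = m%:E)%E ->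
  {ae P, forall t, \forall k \near \oo,
     \sum_(i < N * 2 ^ k) f (Z i t) <= (N * 2 ^ k)%:R * (m + eps)}.
Proof.
move=> N0 e0 mf f0 fm.
pose B k := [set t | (N * 2 ^ k)%:R * (m + eps) < \sum_(i < N * 2 ^ k) f (Z i t)].
have mB k : measurable (B k) by exact: (measurable_sum_gt Z).
have NR0 : 0 < N%:R :> R by rewrite ltr0n.
have NkE k : (N * 2 ^ k)%:R = N%:R * 2 ^+ k :> R by rewrite natrM natrX.
pose g k z := (Num.min (f z) (N * 2 ^ k)%:R ^+ 2 / (N * 2 ^ k)%:R)%:E : \bar R.
have mg k : measurable_fun setT (g k).
  apply/measurable_EFinP; apply: measurable_funM => //.
  by apply: measurable_funX; exact: measurable_minr.
have g0 k z : (0 <= g k z)%E by rewrite lee_fin divr_ge0 ?sqr_ge0.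
have C0 : (0 <= (1 + eps ^- 2)%:E :> \bar R)%E.
  by rewrite lee_fin addr_ge0// invr_ge0 sqr_ge0.
have sumB : (\sum_(k <oo) P (B k) < +oo)%E.
  apply: (@le_lt_trans _ _ (\sum_(k <oo) ((1 + eps ^- 2)%:E * \int[Pi]_z g k z))%E).
    apply: lee_nneseries => // k _.
    by apply: truncated_deviation => //; rewrite muln_gt0 N0 expn_gt0.
  rewrite nneseriesZl//; last by move=> k _; exact: integral_ge0.
  rewrite -integral_nneseries//.
  apply: (@le_lt_trans _ _ ((1 + eps ^- 2)%:E * (4 * m)%:E)%E); last first.
    by rewrite -EFinM ltry.
  rewrite lee_pmul2l//; last by rewrite lte_fin ltr_wpDr// invr_ge0 sqr_ge0.
  have -> : ((4 * m)%:E = \int[Pi]_z (4 * f z)%:E)%E.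
    under eq_integral do rewrite EFinM.
    rewrite ge0_integralZl_EFin ?fm ?EFinM//.
    - by move=> z _; rewrite lee_fin.
    - exact/measurable_EFinP.
  apply: ge0_le_integral => //.
  - by move=> z _; exact: nneseries_ge0.
  - exact: ge0_emeasurable_sum.
  - apply/measurable_EFinP; exact: measurable_funM.
  - move=> z _; apply: lime_le; first exact: is_cvg_nneseries.
    apply: nearW => K; rewrite /g sumEFin lee_fin.
    under eq_bigr do rewrite NkE.
    exact: dyadic_truncation_sum.
exists (lim_sup_set B); split.
- by apply: bigcap_measurable => // n _; exact: bigcup_measurable.
- exact: lim_sup_set_cvg0.
- move=> t /= nt n _; apply: contrapT => nB; apply: nt.
  exists n => // k /= nk; rewrite leNgt; apply/negP => Bk; apply: nB.
  by exists k.
Qed.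

(** As f >= 0, the partial sums increase with n, so it suffices to control them along finitely many
    sequences N 2^k. Half of eps is kept for the gap between n and the next such index. *)
Lemma upper_lln (f : S -> R) (m eps : R) :
  0 < eps -> measurable_fun setT f -> (forall z, 0 <= f z) ->
  (\int[Pi]_z (f z)%:E = m%:E)%E ->
  {ae P, forall t, \forall n \near \oo,
     \sum_(i < n) f (Z i t) <= n%:R * (m + eps)}.
Proof.
move=> e0 mf f0 fm.
have m0 : 0 <= m by rewrite -lee_fin -fm integral_ge0// => z _; rewrite lee_fin.
have e20 : 0 < eps / 2 by rewrite divr_gt0.
(* Chosen so that (N + 1) (m + eps / 2) <= N (m + eps) for all N >= M. *)
pose M := (Num.truncn ((m + eps / 2) / (eps / 2))).+1.
have M0 : 0 < M%:R :> R by rewrite ltr0n.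
have HM : (m + eps / 2) <= M%:R * (eps / 2).
  rewrite -ler_pdivrMr//; apply: ltW; exact: truncnS_gt.
have : {ae P, forall t, forall N, (0 < N)%N -> \forall k \near \oo,
     \sum_(i < N * 2 ^ k) f (Z i t) <= (N * 2 ^ k)%:R * (m + eps / 2)}.
  apply: ae_foralln => -[|N]; first exact: aeW.
  have := upper_lln_dyadic (ltn0Sn N) e20 mf f0 fm.
  by apply: filterS => t H _.
apply: filterS => t H.
(* Sandwich n between N 2^k and (N + 1) 2^k with M <= N < 2 M: passing to the
   larger one multiplies the bound by at most 1 + 1/M. *)
have {H} [k0 H] : exists k0, forall N k, (M <= N <= M.*2)%N -> (k0 <= k)%N ->
    \sum_(i < N * 2 ^ k) f (Z i t) <= (N * 2 ^ k)%:R * (m + eps / 2).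
  have /choice[k0 Hk0] : forall N : nat, exists k0, forall k, (0 < N)%N ->
      (k0 <= k)%N -> \sum_(i < N * 2 ^ k) f (Z i t) <= (N * 2 ^ k)%:R * (m + eps / 2).
    move=> [|N]; first by exists 0%N.
    by have [k0 _ Hk0] := H N.+1 isT; exists k0 => k _ /Hk0.
  exists (\max_(N < M.*2.+1) k0 N)%N => N k /andP[MN NM] kk.
  apply: Hk0; first exact: leq_trans MN.
  by apply: leq_trans kk; rewrite -ltnS in NM; exact: (leq_bigmax (Ordinal NM)).
exists (M * 2 ^ k0)%N => // n /= Mn.
(* k is the largest exponent with M 2^k <= n, which forces M <= N < 2 M. *)
pose k := trunc_log 2 (n %/ M); pose N := (n %/ 2 ^ k)%N.
have nM0 : (0 < n %/ M)%N.
  by rewrite divn_gt0// (leq_trans _ Mn)// leq_pmulr// expn_gt0.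
have /andP[k1 k2] := trunc_log_bounds (isT : 1 < 2)%N nM0.
have kk : (k0 <= k)%N.
  rewrite /k trunc_log_max// leq_divRL// mulnC//.
have kp : (0 < 2 ^ k)%N by rewrite expn_gt0.
have MN : (M <= N)%N by rewrite /N leq_divRL// mulnC -leq_divRL.
have NM : (N < M.*2)%N.
  rewrite /N ltn_divLR// (_ : (M.*2 * 2 ^ k = 2 ^ k.+1 * M)%N) -?ltn_divLR//.
  by rewrite expnS -muln2 -mulnA mulnC.
have nN : (n < N.+1 * 2 ^ k)%N by rewrite -ltn_divLR.
have Nn : (N * 2 ^ k <= n)%N by rewrite leq_divM.
apply: (@le_trans _ _ (\sum_(i < N.+1 * 2 ^ k) f (Z i t))).
  rewrite -!(big_mkord xpredT (fun i => f (Z i t))).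
  by rewrite (big_cat_nat (leq0n n) (ltnW nN))/= lerDl sumr_ge0.
apply: (le_trans (H N.+1 k _ kk)); first by rewrite (leqW MN).
rewrite natrM; set q : R := (2 ^ k)%:R.
have q0 : 0 <= q by rewrite ler0n.
apply: (@le_trans _ _ ((N * 2 ^ k)%:R * (m + eps))); last first.
  by rewrite ler_wpM2r ?ler_nat// addr_ge0// ltW.
rewrite natrM -/q mulrAC [leRHS]mulrAC ler_wpM2r// -natr1.
have MNR : M%:R <= N%:R :> R by rewrite ler_nat.
by nra.
Qed.

End UpperLLN.

(** * Convergence of empirical frequencies *)

Section EmpiricalFrequency.
Context (R : realType) (d d' : measure_display) (T : measurableType d)
  (S : measurableType d') (P : probability T R) (Pi : probability S R)
  (Z : nat -> {RV P >-> S}) (Z_iid : iid_with_law Z Pi).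

(** The one-sided law applied to A gives the upper bound, and applied to the complement of A the
    lower one. *)
Lemma empirical_frequency_cvg (A : set S) : measurable A ->
  {ae P, forall t, (\sum_(i < n) \1_A (Z i t)) / n%:R @[n --> \oo] --> fine (Pi A)}.
Proof.
move=> mA; pose e k : R := k.+1%:R^-1.
have e0 k : 0 < e k by rewrite invr_gt0.
have upper B k : measurable B -> {ae P, forall t, \forall n \near \oo,
    \sum_(i < n) \1_B (Z i t) <= n%:R * (fine (Pi B) + e k)}.
  move=> mB; apply: (upper_lln Z_iid (e0 k)) => //.
  by rewrite integral_indic// setIT fineK// fin_num_measure.
have HA : {ae P, forall t k, \forall n \near \oo,
    \sum_(i < n) \1_A (Z i t) <= n%:R * (fine (Pi A) + e k)}.
  by apply: ae_foralln => k; exact: upper.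
have HC : {ae P, forall t k, \forall n \near \oo,
    \sum_(i < n) \1_(~` A) (Z i t) <= n%:R * (fine (Pi (~` A)) + e k)}.
  by apply: ae_foralln => k; apply: upper; exact: measurableC.
have PiC : fine (Pi (~` A)) = 1 - fine (Pi A).
  by rewrite probability_setC// fineB// fin_num_measure.
apply: filterS2 HA HC => t HA HC.
apply/cvgrPdist_le => eps eps0.
have [k ke] : exists k, e k <= eps.
  have [k _ Hk] := near_infty_natSinv_lt (PosNum eps0).
  by exists k; exact: ltW (Hk k (leqnn k)).
have nbig : \forall n \near \oo, (0 < n)%N by exact: nbhs_infty_gt.
move: (HA k) (HC k) nbig; apply: filterS3 => n H1 H2 n0.
have nR0 : 0 < n%:R :> R by rewrite ltr0n.
have {}H2 : n%:R - \sum_(i < n) \1_A (Z i t) <= n%:R * (1 - fine (Pi A) + e k).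
  rewrite -PiC; apply: le_trans H2.
  rewrite -{1}(card_ord n) -sumr_const -sumrB.
  apply: ler_sum => i _; rewrite !indicE in_setC.
  by case: (_ \in A); rewrite ?subrr ?subr0.
rewrite ler_distlC; apply/andP; split.
  by rewrite ler_pdivlMr//; nra.
by rewrite ler_pdivrMr//; nra.
Qed.

End EmpiricalFrequency.

(** * Costs on a grid *)

Section Grid.
Context (R : realType) (a : nat -> R).

(** The strict comparison matches open rays, of probability 1 - F(a_i). Points left of a_0 are
    rounded up to a_0. *)
Fixpoint grid_floor (N : nat) (x : R) : R :=
  if N is N'.+1 then if a N < x then a N else grid_floor N' x else a 0%N.

(* The ray of index 0 is the whole line, so that the constant term of the
   expansion of a function of the rounded point is indexed by 0. *)
Definition grid_ray (i : nat) : set R :=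
  if i is 0%N then setT else `]a i, +oo[%classic.

Definition grid_incr (f : R -> R) (i : nat) : R :=
  if i is i'.+1 then f (a i) - f (a i') else f (a 0%N).

(** For i, j >= 1 this is the increment of c over a grid cell; an index 0 gives a boundary term, of
    no definite sign. *)
Definition grid_mass (c : R -> R -> R) (i j : nat) : R :=
  grid_incr (fun x => grid_incr (c x) j) i.

Hypothesis a_nd : {homo a : i j / (i <= j)%N >-> i <= j}.

Lemma grid_floor_above (N : nat) (x : R) : a N < x -> grid_floor N x = a N.
Proof. by case: N => //= N ->. Qed.

(** Telescoping: starting from f(a_0), the increments at the points a_i < x lead to f at the last
    such point. *)
Lemma grid_floorE (f : R -> R) (N : nat) (x : R) :
  f (grid_floor N x) = \sum_(i < N.+1) grid_incr f i * \1_(grid_ray i) x.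
Proof.
elim: N => [|N IH]; first by rewrite big_ord_recl big_ord0 /= indicT mulr1 addr0.
rewrite big_ord_recr /= -IH indicE; case: ifPn => Nx.
  rewrite mem_set ?mulr1; last by rewrite /= in_itv/= Nx.
  by rewrite (@grid_floor_above N) 1?addrC ?subrK// (le_lt_trans _ Nx)// a_nd.
by rewrite memNset ?mulr0 ?addr0//= in_itv/= andbT; exact/negP.
Qed.

Lemma grid_floor2E (c : R -> R -> R) (N : nat) (x y : R) :
  c (grid_floor N x) (grid_floor N y) =
  \sum_(p : 'I_N.+1 * 'I_N.+1)
    grid_mass c p.1 p.2 * \1_(grid_ray p.1 `*` grid_ray p.2) (x, y).
Proof.
rewrite (grid_floorE (c ^~ (grid_floor N y))).
rewrite -(pair_bigA _ (fun i j : 'I_N.+1 =>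
  grid_mass c i j * \1_(grid_ray i `*` grid_ray j) (x, y)))/=.
apply: eq_bigr => i _.
have -> : grid_incr (c ^~ (grid_floor N y)) i =
    \sum_(j < N.+1) grid_mass c i j * \1_(grid_ray j) y.
  case: i => -[|i] /= _; rewrite !grid_floorE// -sumrB.
  by apply: eq_bigr => j _; rewrite /grid_mass/= mulrBl.
rewrite mulr_suml; apply: eq_bigr => j _.
rewrite -mulrA; congr (_ * _); rewrite !indicE in_setX/= mulrC.
by case: (x \in _); rewrite ?mul1r ?mul0r.
Qed.

Lemma grid_mass_le0 (c : R -> R -> R) (i j : nat) : good_cost c ->
  (0 < i)%N -> (0 < j)%N -> grid_mass c i j <= 0.
Proof.
move=> c_good; case: i j => [|i] [|j]// _ _; rewrite /grid_mass/=.
have := c_good _ _ _ _ (a_nd (leqnSn i)) (a_nd (leqnSn j)); lra.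
Qed.

Lemma grid_floor_le (N : nat) (x : R) : grid_floor N x <= Num.max x (a 0%N).
Proof.
elim: N => [|N IH] /=; first by rewrite le_max lexx orbT.
by case: ifP => // /ltW Nx; rewrite le_max Nx.
Qed.

Lemma grid_floor_near (N : nat) (h x : R) :
  (forall i, a i.+1 = a i + h) -> a 0%N < x -> x <= a N ->
  x - h <= grid_floor N x <= x.
Proof.
move=> ah x0; have h0 : 0 <= h by have := a_nd (leqnSn 0); rewrite ah; lra.
elim: N => [|N IH] /= xN; first by move: x0; rewrite ltNge xN.
rewrite [a N.+1 < x]ltNge xN/=; have [xN'|Nx] := leP x (a N); first exact: IH.
by rewrite grid_floor_above//; rewrite ah in xN; lra.
Qed.

Lemma measurable_grid_ray (i : nat) : measurable (grid_ray i).
Proof. by case: i => [|i] /=; [exact: measurableT|exact: measurable_itv]. Qed.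

End Grid.

(** The weights may be negative, so linearity goes through the integrability of each indicator. *)
Lemma integral_weighted_indic (R : realType) (d : measure_display)
    (T : measurableType d) (P : probability T R) (I : finType) (w : I -> R)
    (E : I -> set T) : (forall i, measurable (E i)) ->
  (\int[P]_t (\sum_i w i * \1_(E i) t)%:E = (\sum_i w i * fine (P (E i)))%:E)%E.
Proof.
move=> mE; under eq_integral do rewrite -sumEFin.
have iE i : P.-integrable setT (fun t => (\1_(E i) t)%:E : \bar R).
  by apply: integrable_indic => //; rewrite setIT.
rewrite integral_sum//; last first.
  move=> i; under [X in _.-integrable _ X]eq_fun do rewrite EFinM.
  exact: integrableZl.
rewrite -sumEFin; apply: eq_bigr => i _.
under eq_integral do rewrite EFinM.
by rewrite integralZl// integral_indic// setIT EFinM fineK// fin_num_measure.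
Qed.

(** * Grid costs of couplings *)

Section GridCost.
Context (R : realType) (a : nat -> R) (a_nd : {homo a : i j / (i <= j)%N >-> i <= j}).

Definition grid_tail (F : R -> R) (i : nat) : R :=
  if i is 0%N then 1 else 1 - F (a i).

(** The quantity I(F, G): joint tail probabilities are replaced with their Frechet upper bound. *)
Definition grid_cost (N : nat) (c : R -> R -> R) (F G : R -> R) : R :=
  \sum_(p : 'I_N.+1 * 'I_N.+1)
    grid_mass a c p.1 p.2 * Num.min (grid_tail F p.1) (grid_tail G p.2).

Lemma grid_cost_cvg (N : nat) (c : R -> R -> R) (F G : R -> R)
    (Fn Gn : nat -> R -> R) :
  (forall i, Fn n (a i) @[n --> \oo] --> F (a i)) ->
  (forall i, Gn n (a i) @[n --> \oo] --> G (a i)) ->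
  grid_cost N c (Fn n) (Gn n) @[n --> \oo] --> grid_cost N c F G.
Proof.
move=> cF cG.
have tail_cvg (H : R -> R) (Hn : nat -> R -> R) i :
    (forall i, Hn n (a i) @[n --> \oo] --> H (a i)) ->
    grid_tail (Hn n) i @[n --> \oo] --> grid_tail H i.
  move=> cH; case: i => [|i] /=; first exact: cvg_cst.
  by apply: cvgB => //; exact: cvg_cst.
apply: cvg_big => [|p _]; first exact: add_continuous.
apply: cvgM; first exact: cvg_cst.
(* Writing min(x, y) as (x + y - |x - y|) / 2 leaves only sums, products and norms. *)
under eq_cvg do rewrite minr_absE.
rewrite minr_absE; apply: cvgM; last exact: cvg_cst.
have cFi := tail_cvg F Fn p.1 cF; have cGi := tail_cvg G Gn p.2 cG.
by apply: cvgB; [exact: cvgD|apply: cvg_norm; exact: cvgB].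
Qed.

(** By [grid_floor2E] this is a finite combination of indicators of rectangles; the measurability of
    c itself will be derived from it. *)
Lemma measurable_grid_floor_cost (d : measure_display) (T : measurableType d)
    (X Y : T -> R) (N : nat) (c : R -> R -> R) :
  measurable_fun setT X -> measurable_fun setT Y ->
  measurable_fun setT (fun t => c (grid_floor a N (X t)) (grid_floor a N (Y t))).
Proof.
move=> mX mY; under eq_fun do rewrite grid_floor2E//.
apply: measurable_sum => p; apply: measurable_funM => //.
have mA := measurableX (measurable_grid_ray a p.1) (measurable_grid_ray a p.2).
have mI : measurable_fun setT
    (\1_(grid_ray a p.1 `*` grid_ray a p.2) : R * R -> R).
  exact: measurable_indic.
have mXY : measurable_fun setT (fun t => (X t, Y t)) by exact: measurable_fun_pair.
exact: measurableT_comp mI mXY.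
Qed.

Section Coupling.
Context (d : measure_display) (T : measurableType d) (P : probability T R)
  (X Y : {RV P >-> R}).

Definition ray_probability (i j : nat) : R :=
  fine (P (X @^-1` grid_ray a i `&` Y @^-1` grid_ray a j)).

Lemma measurable_preimage_ray (W : {RV P >-> R}) (i : nat) :
  measurable (W @^-1` grid_ray a i).
Proof. by apply: measurable_funPTI; exact: measurable_grid_ray. Qed.

Lemma expectation_grid_floor (N : nat) (c : R -> R -> R) :
  (\int[P]_t (c (grid_floor a N (X t)) (grid_floor a N (Y t)))%:E =
   (\sum_(p : 'I_N.+1 * 'I_N.+1) grid_mass a c p.1 p.2 * ray_probability p.1 p.2)%:E)%E.
Proof.
rewrite -integral_weighted_indic; last first.
  by move=> p; apply: measurableI; exact: measurable_preimage_ray.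
by apply: eq_integral => t _; rewrite grid_floor2E.
Qed.

Lemma has_cdf_ray (W : {RV P >-> R}) (F : R -> R) (i : nat) : has_cdf W F ->
  P (W @^-1` grid_ray a i) = (grid_tail F i)%:E.
Proof.
move=> WF; case: i => [|i] /=; first by rewrite preimage_setT probability_setT.
have mW : measurable (W @^-1` `]-oo, a i.+1]%classic).
  by apply: measurable_funPTI; exact: measurable_itv.
rewrite -setCitvl -preimage_setC probability_setC//.
by have := WF (a i.+1); rewrite /cdf /distribution/= /pushforward => ->.
Qed.

Lemma grid_tail_le1 (W : {RV P >-> R}) (F : R -> R) (i : nat) :
  has_cdf W F -> grid_tail F i <= 1.
Proof.
move=> WF; rewrite -lee_fin -(has_cdf_ray _ WF) probability_le1//.
exact: measurable_preimage_ray.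
Qed.

(** Joint tails lie below the Frechet bound and carry nonpositive masses; this is where the goodness
    of c enters. *)
Lemma grid_cost_le (N : nat) (c : R -> R -> R) (F G : R -> R) :
  good_cost c -> has_cdf X F -> has_cdf Y G ->
  ((grid_cost N c F G)%:E <=
    \int[P]_t (c (grid_floor a N (X t)) (grid_floor a N (Y t)))%:E)%E.
Proof.
move=> c_good XF YG; rewrite expectation_grid_floor lee_fin.
apply: ler_sum => -[i j] _ /=; rewrite /ray_probability.
(* Boundary terms have no definite sign, but when one ray is the whole line the joint probability
   equals the minimum for every coupling. *)
case: (posnP i) => [->|i0].
  rewrite /= preimage_setT setTI (has_cdf_ray _ YG)/= min_r//; exact: grid_tail_le1 YG.
case: (posnP j) => [->|j0].
  rewrite /= preimage_setT setIT (has_cdf_ray _ XF)/= min_l//; exact: grid_tail_le1 XF.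
apply: ler_wnM2l; first exact: grid_mass_le0.
have mI := measurableI _ _ (measurable_preimage_ray X i) (measurable_preimage_ray Y j).
rewrite le_min -!lee_fin fineK ?fin_num_measure//.
rewrite -(has_cdf_ray _ XF) -(has_cdf_ray _ YG).
by apply/andP; split; apply: le_measure; rewrite ?inE//; exact: measurable_preimage_ray.
Qed.

Lemma grid_cost_comonotone (N : nat) (c : R -> R -> R) (F G : R -> R) :
  has_cdf X F -> has_cdf Y G ->
  (forall r s, P (X @^-1` `]r, +oo[ `&` Y @^-1` `]s, +oo[) =
     (Num.min (1 - F r) (1 - G s))%:E) ->
  (\int[P]_t (c (grid_floor a N (X t)) (grid_floor a N (Y t)))%:E =
    (grid_cost N c F G)%:E)%E.
Proof.
move=> XF YG XY; rewrite expectation_grid_floor; congr (_%:E).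
apply: eq_bigr => -[[i iN] [j jN]] _ /=; congr (_ * _); rewrite /ray_probability.
case: i iN => [|i] _.
  rewrite /= preimage_setT setTI (has_cdf_ray _ YG)/= min_r//; exact: grid_tail_le1 YG.
case: j jN => [|j] _.
  have -> : Y @^-1` grid_ray a 0 = setT by [].
  rewrite setIT (has_cdf_ray _ XF) min_l//; exact: grid_tail_le1 XF.
by rewrite /= XY.
Qed.

End Coupling.
End GridCost.

(** * The quantile coupling *)

Section CdfFacts.
Context (R : realType) (d : measure_display) (T : measurableType d)
  (P : probability T R) (X : {RV P >-> R}) (F : R -> R) (XF : has_cdf X F).

Lemma has_cdfE : F = fine \o cdf X.
Proof. by apply/funext => r /=; rewrite XF. Qed.

Lemma has_cdf_nd : {homo F : x y / x <= y}.
Proof. by move=> x y xy; rewrite -lee_fin -!XF; exact: cdf_nondecreasing. Qed.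

Lemma has_cdf_itv (r : R) : 0 <= F r <= 1.
Proof. by rewrite -!lee_fin -XF cdf_ge0 cdf_le1. Qed.

Lemma has_cdf_right (r u : R) : (forall s, r < s -> u <= F s) -> u <= F r.
Proof.
move=> H; have Fr : F x @[x --> r^'+] --> F r.
  rewrite has_cdfE; apply: fine_cvg; rewrite fineK ?XF//.
  by rewrite -XF; exact: cdf_right_continuous.
rewrite leNgt; apply/negP => Fru.
have [s [Fs rs]] : exists s, F s < u /\ r < s.
  apply: (filter_ex (F := r^'+)); apply: filterI; last exact: nbhs_right_gt.
  exact: (cvgr_lt _ Fr).
by have := H s rs; rewrite leNgt Fs.
Qed.

Lemma has_cdf_near1 (u : R) : u < 1 -> exists r, u <= F r.
Proof.
move=> u1; have Fy : F x @[x --> +oo] --> (1 : R).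
  by rewrite has_cdfE; apply: fine_cvg; exact: cvg_cdfy1.
by have [r ur] := filter_ex (cvgr_ge _ Fy u u1); exists r.
Qed.

Lemma has_cdf_near0 (u : R) : 0 < u -> exists r, F r < u.
Proof.
move=> u0; have FN : F x @[x --> -oo] --> (0 : R).
  by rewrite has_cdfE; apply: fine_cvg; exact: cvg_cdfNy0.
by have [r ur] := filter_ex (cvgr_lt _ FN u u0); exists r.
Qed.

End CdfFacts.

(** Meant for 0 < u < 1; elsewhere the set may be empty or unbounded below, and [inf] is then a
    default value. *)
Definition quantile (R : realType) (F : R -> R) (u : R) : R :=
  inf [set r | u <= F r].

Section Quantile.
Context (R : realType).

(** The limits of F at infinity make the set nonempty and bounded below; right continuity puts the
    infimum in it. *)
Lemma quantile_le (d : measure_display) (T : measurableType d)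
    (P : probability T R) (X : {RV P >-> R}) (F : R -> R) (u r : R) :
  has_cdf X F -> 0 < u < 1 -> (quantile F u <= r) = (u <= F r).
Proof.
move=> XF /andP[u0 u1]; pose A := [set r | u <= F r].
have A0 : A !=set0 by have [s us] := has_cdf_near1 XF u1; exists s.
have lbA : has_lbound A.
  have [s su] := has_cdf_near0 XF u0; exists s => x /= ux.
  rewrite leNgt; apply/negP => /ltW /(has_cdf_nd XF) xs.
  by have := le_lt_trans (le_trans ux xs) su; rewrite ltxx.
apply/idP/idP => [qr|ur]; last exact: ge_inf.
apply: le_trans (has_cdf_nd XF qr).
apply: (has_cdf_right XF) => s.
by move=> /inf_lt[|x /= ux /ltW /(has_cdf_nd XF)]//; exact: le_trans.
Qed.

Let U01 := uniform_prob (@ltr01 R).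

(** A is only described on ]0, 1[, where quantiles behave; within [0, 1] it is squeezed between ]v,
    1[ and ]v, 1[ plus the two null endpoints. *)
Lemma uniform_prob_ray (v : R) (A : set R) : 0 <= v <= 1 -> measurable A ->
  (forall u, 0 < u < 1 -> (A u <-> v < u)) -> U01 A = (1 - v)%:E.
Proof.
move=> /andP[v0 v1] mA Av.
have mAI : measurable (A `&` `[0, 1]%classic) by apply: measurableI.
have -> : U01 A = lebesgue_measure (A `&` `[0, 1]%classic).
  rewrite /U01 /uniform_prob integral_uniform_pdf.
  rewrite (eq_integral (cst 1%E)) ?integral_cst ?mul1e//.
  move=> x; rewrite inE => -[_ /=]; rewrite in_itv/= /uniform_pdf => ->.
  by rewrite subr0 invr1.
have len a b : a <= b -> lebesgue_measure (`]a, b[%classic : set R) = (b - a)%:E.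
  move=> ab; rewrite lebesgue_measure_itv/= lte_fin; case: ltP => // ba.
  have -> : a = b by apply/le_anti/andP.
  by rewrite subrr.
apply/eqP; rewrite eq_le; apply/andP; split.
  pose C : set R := `]v, 1[%classic `|` ([set 0] `|` [set 1]).
  apply: (@le_trans _ _ (lebesgue_measure C)).
    apply: le_measure; rewrite ?inE//; first by do 2!apply: measurableU => //.
    move=> x [Ax] /=; rewrite in_itv/= => /andP[x0 x1].
    have [->|xN0] := eqVneq x 0; first by right; left.
    have [->|xN1] := eqVneq x 1; first by right; right.
    left; have x01 : 0 < x < 1 by rewrite !lt_neqAle eq_sym xN0 x0 xN1 x1.
    by rewrite /= in_itv/= (andP x01).2 andbT; apply/(Av _ x01).
  rewrite -(len _ _ v1).
  apply: (le_trans (measureU2 _ _ _)) => //; first exact: measurableU.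
  rewrite -[leRHS]adde0 leeD2l//.
  apply: (le_trans (measureU2 _ _ _)) => //.
  by rewrite /= !lebesgue_measure_set1 adde0.
rewrite -(len _ _ v1); apply: le_measure; rewrite ?inE//.
move=> x /=; rewrite in_itv/= => /andP[vx x1].
have x0 := le_lt_trans v0 vx.
by split; [apply/Av => //; rewrite x0|rewrite in_itv/= !ltW].
Qed.

Lemma quantile_rv (d : measure_display) (T : measurableType d)
    (P : probability T R) (X : {RV P >-> R}) (F : R -> R) : has_cdf X F ->
  exists Q : {RV U01 >-> R}, forall u, 0 < u < 1 -> Q u = quantile F u.
Proof.
move=> XF; pose Q u := if 0 < u < 1 then quantile F u else 0.
have mQ : @measurable_fun _ _ (measurableTypeR R) R setT Q.
  apply: (measurability (@RGenOInfty.G R)) => [|/= _ [_] [r] -> <-].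
    exact: RGenOInfty.measurableE.
  rewrite setTI.
  (* By [quantile_le], Q u > r means u > F r on ]0, 1[; outside, Q is 0. *)
  have -> : Q @^-1` `]r, +oo[ = (`]0, 1[ `&` `]F r, +oo[) `|`
     (~` `]0, 1[ `&` [set u : R | r < 0]).
    apply/seteqP; split => u /=; rewrite !in_itv/= !andbT /Q.
      case: ifPn => u01 H; [left; split => //|by right].
      by move: H; rewrite ltNge (quantile_le _ XF)// -ltNge.
    case=> -[u01 H]; last by rewrite (negbTE (introN idP u01)).
    by rewrite u01 ltNge (quantile_le _ XF)// -ltNge.
  apply: measurableU; apply: measurableI => //; first exact: measurableC.
  have [r0|r0] := boolP (r < 0).
    by rewrite (_ : [set _ | _] = setT)//; apply/seteqP.
  by rewrite (_ : [set _ | _] = set0)//; apply/seteqP; split => x //= /(negP r0).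
pose Q' : {RV U01 >-> R} :=
  HB.pack Q (isMeasurableFun.Build _ _ (measurableTypeR R) R Q mQ).
by exists Q' => u u01; rewrite /Q' /= /Q u01.
Qed.

(** Both quantile functions are evaluated at the same uniform u, so both tail events together say u
    > max(F r, G s). *)
Lemma comonotone_coupling (d : measure_display) (T : measurableType d)
    (P : probability T R) (X Y : {RV P >-> R}) (F G : R -> R) :
  has_cdf X F -> has_cdf Y G ->
  exists X' Y' : {RV U01 >-> R}, [/\ has_cdf X' F, has_cdf Y' G &
    forall r s, U01 (X' @^-1` `]r, +oo[ `&` Y' @^-1` `]s, +oo[) =
     (Num.min (1 - F r) (1 - G s))%:E].
Proof.
move=> XF YG; have [X' X'E] := quantile_rv XF; have [Y' Y'E] := quantile_rv YG.
exists X', Y'.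
have cdfE d0 (T0 : measurableType d0) (P0 : probability T0 R)
  (W : {RV P0 >-> R}) H (W' : {RV U01 >-> R}) : has_cdf W H ->
  (forall u, 0 < u < 1 -> W' u = quantile H u) -> has_cdf W' H.
  move=> WH W'E r; rewrite /cdf /distribution/= /pushforward.
  have mr : measurable (W' @^-1` `]r, +oo[%classic).
    by apply: measurable_funPTI; exact: measurable_itv.
  rewrite -setCitvr -preimage_setC probability_setC//.
  transitivity (1 - (1 - H r)%:E)%E; last by rewrite -EFinB opprB addrC subrK.
  congr (1 - _)%E; apply: (uniform_prob_ray (has_cdf_itv WH r)) => // u u01.
  by rewrite /= in_itv/= andbT W'E// ltNge (quantile_le _ WH)// -ltNge.
split; [exact: cdfE XF X'E|exact: cdfE YG Y'E|move=> r s].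
have -> : Num.min (1 - F r) (1 - G s) = 1 - Num.max (F r) (G s).
  by rewrite oppr_max addr_minr.
apply: uniform_prob_ray.
- have /andP[F0 F1] := has_cdf_itv XF r; have /andP[G0 G1] := has_cdf_itv YG s.
  by rewrite le_max F0 ge_max F1 G1.
- have mray (W : {RV U01 >-> R}) q : measurable (W @^-1` `]q, +oo[%classic).
    by apply: measurable_funPTI; exact: measurable_itv.
  exact: measurableI (mray X' r) (mray Y' s).
- move=> u u01 /=; rewrite !in_itv/= !andbT X'E// Y'E// gt_max.
  rewrite ![_ < quantile _ _]ltNge (quantile_le _ XF)// (quantile_le _ YG)// -!ltNge.
  by split => [[-> ->]|/andP[]].
Qed.

End Quantile.

(** Open rays are stable under intersection and generate the Borel sets, so the c.d.f. determines
    the law. Thus E tau(X) is the same in all couplings. *)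
Lemma has_cdf_integral (R : realType) (d d' : measure_display)
    (T : measurableType d) (T' : measurableType d') (P : probability T R)
    (P' : probability T' R) (X : {RV P >-> R}) (X' : {RV P' >-> R})
    (F : R -> R) (f : R -> \bar R) : has_cdf X F -> has_cdf X' F ->
  measurable_fun setT f -> (forall x, 0 <= f x)%E ->
  (\int[P]_t f (X t) = \int[P']_t f (X' t))%E.
Proof.
move=> XF X'F mf f0.
rewrite -(ge0_integral_distribution X mf f0) -(ge0_integral_distribution X' mf f0).
apply: eq_measure_integral => A mA _.
pose g n : set R := `](- n%:R)%R, +oo[%classic.
apply: (measure_unique (@RGenOInfty.G R) g) => //.
- exact: RGenOInfty.measurableE.
- move=> _ _ [x ->] [y ->]; exists (Num.max x y).
  by apply/seteqP; split => z /=; rewrite !in_itv/= !andbT gt_max => /andP.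
- by move=> n; exists (- n%:R).
- apply/seteqP; split => // x _; exists (Num.truncn `|x|).+1 => //.
  rewrite /g/= in_itv/= andbT ltrNl (le_lt_trans _ (truncnS_gt _))//.
  by rewrite -normrN ler_norm.
- move=> _ [x ->].
  (* A constant grid, at index 1 since index 0 denotes the whole line. *)
  exact: etrans (has_cdf_ray (fun=> x) 1%N XF) (esym (has_cdf_ray (fun=> x) 1%N X'F)).
- move=> n; apply: le_lt_trans (probability_le1 (distribution P X) _) (ltry 1).
  exact: measurable_itv.
Qed.

(** The uniform measure on the first n points. For pairs it is a law with the empirical marginals,
    so results on (F, G) apply to the empirical pair verbatim. *)
Lemma empirical_law (R : realType) (d : measure_display) (S : measurableType d)
    (z : nat -> S) (n : nat) : (0 < n)%N ->
  exists Q : probability S R, forall f : S -> R, measurable_fun setT f ->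
    (forall s, 0 <= f s) ->
    (\int[Q]_s (f s)%:E = ((\sum_(i < n) f (z i)) / n%:R)%:E)%E.
Proof.
move=> n0; have nV0 : 0 <= n%:R^-1 :> R by rewrite invr_ge0.
pose k : {nonneg R} := NngNum nV0.
pose m := mscale k (msum (fun i => \d_(z i) : {measure set S -> \bar R}) n).
have mI (f : S -> R) : measurable_fun setT f -> (forall s, 0 <= f s) ->
    (\int[m]_s (f s)%:E = ((\sum_(i < n) f (z i)) / n%:R)%:E)%E.
  move=> mf f0; have mfE : measurable_fun setT (EFin \o f) by exact/measurable_EFinP.
  rewrite /m ge0_integral_mscale//; last by move=> s _; rewrite lee_fin.
  rewrite ge0_integral_measure_sum//; last by move=> s _; rewrite lee_fin.
  under eq_bigr do rewrite integral_dirac// diracT mul1e.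
  by rewrite sumEFin -EFinM mulrC.
have m1 : m setT = 1%E.
  have := mI (cst 1) (measurable_cst _) (fun=> ler01).
  have -> : (\int[m]_s (cst (1 : R) s)%:E = m setT)%E.
    by rewrite -[RHS]mul1e -(integral_cst m measurableT 1%E).
  move=> ->.
  by rewrite sumr_const card_ord divff// pnatr_eq0 -lt0n.
pose Q : probability S R := HB.pack m (Measure_isProbability.Build _ _ R m m1).
by exists Q.
Qed.

(** * Uniform continuity and measurability of continuous costs *)

Section ContinuousCost.
Context (R : realType) (c : R -> R -> R)
  (c_cont : continuous (fun z : R * R => c z.1 z.2)).

(** Near each z a common h works, by continuity at z and the triangle inequality; compactness of the
    square makes h uniform. Only the first point has to lie in the square. *)
Lemma uniform_continuity_square (l u e : R) : 0 < e ->
  exists2 h, 0 < h & forall x y x' y', l <= x <= u -> l <= y <= u ->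
    `|x - x'| < h -> `|y - y'| < h -> `|c x y - c x' y'| <= e.
Proof.
move=> e0; have e20 : 0 < e / 2 by rewrite divr_gt0.
have cK : compact (`[l, u]%classic `*` `[l, u]%classic : set (R * R)).
  by apply: compact_setX; exact: segment_compact.
pose Pr (h : R) (z : R * R) := forall z' : R * R, `|z.1 - z'.1| < h ->
  `|z.2 - z'.2| < h -> `|c z.1 z.2 - c z'.1 z'.2| <= e.
have near_Pr (z : R * R) : \forall z' \near z & h \near (0 : R)^'+, Pr h z'.
  have /cvgrPdist_lt/(_ _ e20)/nbhs_ballP[r /= r0 Hr] := c_cont (x := z).
  have r20 : 0 < r / 2 by rewrite divr_gt0.
  exists (ball z (r / 2), [set h | h < r / 2]) => /=.
    by split; [exact: nbhsx_ballx|exact: nbhs_right_lt].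
  move=> [z' h] /= [[b1 b2] hr] w w1 w2.
  have cz : `|c z.1 z.2 - c z'.1 z'.2| < e / 2.
    apply: Hr; split; apply: le_ball (_ : r / 2 <= r) _ _ => //; lra.
  have cw : `|c z.1 z.2 - c w.1 w.2| < e / 2.
    apply: Hr; rewrite (splitr r).
    by split; [apply: ball_triangle b1 _|apply: ball_triangle b2 _];
      rewrite -ball_normE/= (lt_trans _ hr).
  rewrite (le_trans (ler_distD (c z.1 z.2) _ _))//.
  by rewrite (splitr e) ltW// ltrD// distrC.
have hK : \forall h \near (0 : R)^'+,
    `[l, u]%classic `*` `[l, u]%classic `<=` Pr h.
  by apply: (compact_near_coveringP _).1 => // z _; exact: near_Pr.
have h0 : \forall h \near (0 : R)^'+, 0 < h by exact: nbhs_right_gt.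
have [h [{}hK {}h0]] : exists h, `[l, u]%classic `*` `[l, u]%classic `<=` Pr h
    /\ 0 < h.
  by apply: (filter_ex (F := (0 : R)^'+)); exact: filterI.
exists h => // x y x' y' xlu ylu.
exact: (hK (x, y)) (conj xlu ylu) (x', y').
Qed.

(** c is the pointwise limit of its roundings on grids of mesh 1 / (k + 1) covering [-k, k]. *)
Lemma measurable_cost : measurable_fun setT (fun z : R * R => c z.1 z.2).
Proof.
pose a (k i : nat) : R := - k%:R + i%:R / k.+1%:R.
pose N k := (2 * k * k.+1)%N.
have aS k i : a k i.+1 = a k i + k.+1%:R^-1.
  by rewrite /a -natr1 mulrDl mul1r addrA.
have a_nd k : {homo a k : i j / (i <= j)%N >-> i <= j}.
  by move=> i j ij; rewrite lerD2l ler_pM2r ?invr_gt0// ler_nat.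
have a0 k : a k 0%N = - k%:R by rewrite /a mul0r addr0.
have aN k : a k (N k) = k%:R.
  by rewrite /a /N natrM mulfK// natrM; lra.
have rho_cvg x : grid_floor (a k) (N k) x @[k --> \oo] --> x.
  apply/cvgrPdist_le => e e0; near=> k.
  have xk : `|x| < k%:R.
    near: k; apply: filterS (nbhs_infty_ge (Num.truncn `|x|).+1) => k /= xk.
    by rewrite (lt_le_trans (truncnS_gt _))// ler_nat.
  have ke : k.+1%:R^-1 < e.
    by near: k; exact: (near_infty_natSinv_lt (PosNum e0)).
  have := grid_floor_near (a_nd k) (aS k) (x := x) (N := N k).
  rewrite a0 aN => /(_ _ _)/andP[| |rl ru].
  - by move: xk; rewrite ltr_norml => /andP[].
  - by move: xk; rewrite ltr_norml => /andP[_ /ltW].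
  - rewrite ger0_norm ?subr_ge0//; apply: le_trans (ltW ke).
    by rewrite lerBlDr addrC -lerBlDr.
apply: (measurable_fun_cvg (h := fun k z =>
    c (grid_floor (a k) (N k) z.1) (grid_floor (a k) (N k) z.2))) => [k|z _].
  by apply: measurable_grid_floor_cost.
apply: (@cvg_comp _ _ _ (fun k => (grid_floor (a k) (N k) z.1,
  grid_floor (a k) (N k) z.2)) (fun z => c z.1 z.2) _ (nbhs z)); last exact: c_cont.
case: z => x y /=; exact: cvg_pair (rho_cvg x) (rho_cvg y).
Unshelve. all: by end_near. Qed.

End ContinuousCost.

(** * Rounding error and convergence *)

Lemma integral_le_perturbation (R : realType) (d : measure_display)
    (T : measurableType d) (P : probability T R) (f g k : T -> R) (K : R) :
  measurable_fun setT f -> measurable_fun setT g -> measurable_fun setT k ->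
  (forall t, 0 <= f t) -> (forall t, 0 <= g t) -> (forall t, 0 <= k t) ->
  (forall t, f t <= g t + k t) -> (\int[P]_t (k t)%:E = K%:E)%E ->
  (\int[P]_t (f t)%:E <= \int[P]_t (g t)%:E + K%:E)%E.
Proof.
move=> mf mg mk f0 g0 k0 fgk <-.
rewrite -ge0_integralD//; last 4 first.
- by move=> t _; rewrite lee_fin.
- exact/measurable_EFinP.
- by move=> t _; rewrite lee_fin.
- exact/measurable_EFinP.
apply: ge0_le_integral => //.
- by move=> t _; rewrite lee_fin.
- exact/measurable_EFinP.
- by apply: emeasurable_funD; exact/measurable_EFinP.
- by move=> t _; rewrite -EFinD lee_fin.
Qed.

(** Dominated convergence, with k itself as dominating function. *)
Lemma integral_vanishing_tail (R : realType) (d : measure_display)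
    (S : measurableType d) (Q : probability S R) (k : S -> R)
    (E : nat -> set S) (e : R) : 0 < e ->
  measurable_fun setT k -> (forall s, 0 <= k s) ->
  (\int[Q]_s (k s)%:E < +oo)%E -> (forall n, measurable (E n)) ->
  (forall s, \forall n \near \oo, ~ E n s) ->
  \forall n \near \oo, (\int[Q]_s (k s * \1_(E n) s)%:E <= e%:E)%E.
Proof.
move=> e0 mk k0 kfin mE Enear.
have mkE : measurable_fun setT (EFin \o k) by exact/measurable_EFinP.
have ik : Q.-integrable setT (EFin \o k).
  apply/integrableP; split => //.
  by under eq_integral do rewrite gee0_abs ?lee_fin//.
have : (\int[Q]_s (k s * \1_(E n) s)%:E)%E @[n --> \oo] --> (\int[Q]_s (cst 0%E s))%E.
  apply: (@dominated_cvg _ _ _ _ _ measurableT _ _ (EFin \o k)) => //.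
  - by move=> n; apply/measurable_EFinP; exact: measurable_funM.
  - move=> s _; apply: cvg_near_cst; apply: filterS (Enear s) => n nE.
    by rewrite indicE memNset// mulr0.
  - move=> n s _; have /andP[i0 i1] : (0 : R) <= \1_(E n) s <= (1 : R).
      by rewrite indicE; case: (s \in E n); rewrite /= lexx ler01.
    by rewrite /= lee_fin ger0_norm ?mulr_ge0// ler_piMr.
rewrite integral0 => /fine_cvgP[fin /cvgr_le/(_ e e0)].
apply: filterS2 fin => n nfin.
by rewrite -lee_fin fineK.
Qed.

(** * Rounding error of a dominated cost *)

Section Approximation.
Context (R : realType) (c : R -> R -> R) (V : R -> R)
  (c_good : good_cost c) (c_cont : continuous (fun z : R * R => c z.1 z.2))
  (c_ge0 : forall x y : R, 0 <= c x y) (c_le : forall x y : R, c x y <= V x + V y)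
  (V_nd : {homo V : x y / x <= y}).

Lemma dominating_ge0 (x : R) : 0 <= V x.
Proof. by have := le_trans (c_ge0 x x) (c_le x x); lra. Qed.

(* Left of -A it is the constant V M + V 0, not V x + V 0: when x <= -A and
   y <= M, the term V y has to be controlled by the bound at x. *)
Definition tail_bound (A M x : R) : R :=
  Num.max (V x + V 0) (V M + V 0) * \1_(~` `]- A, M]%classic) x.

Lemma tail_bound_ge0 (A M x : R) : 0 <= tail_bound A M x.
Proof.
by rewrite mulr_ge0// le_max addr_ge0 ?dominating_ge0.
Qed.

Lemma measurable_dominating : measurable_fun setT V.
Proof. exact: nondecreasing_measurable. Qed.

Lemma measurable_tail_bound (A M : R) : measurable_fun setT (tail_bound A M).
Proof.
apply: measurable_funM.
  apply: measurable_maxr => //; apply: measurable_funD => //.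
  exact: measurable_dominating.
by apply: measurable_indic; exact: measurableC.
Qed.

(** Uniform continuity handles the pairs in the square of ]-A, M], and domination by V the
    others. *)
Lemma cost_grid_approximation (A M e : R) : 0 <= A -> 0 <= M -> 0 < e ->
  exists (a : nat -> R) (N : nat), {homo a : i j / (i <= j)%N >-> i <= j} /\
    forall x y, `|c x y - c (grid_floor a N x) (grid_floor a N y)| <=
      e + 2 * (tail_bound A M x + tail_bound A M y).
Proof.
move=> A0 M0 e0.
have [h h0 ch] := uniform_continuity_square c_cont (- A) M e0.
have AM0 : 0 <= A + M by rewrite addr_ge0.
pose n := Num.truncn ((A + M) / h); pose s := (A + M) / n.+1%:R.
have s0 : 0 <= s by rewrite divr_ge0.
have sh : s < h.
  by rewrite ltr_pdivrMr// mulrC -ltr_pdivrMr// truncnS_gt.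
pose a i := - A + i%:R * s; pose N := n.+1.
have aS i : a i.+1 = a i + s by rewrite /a -natr1; ring.
have a_nd : {homo a : i j / (i <= j)%N >-> i <= j}.
  by move=> i j ij; rewrite lerD2l ler_wpM2r// ler_nat.
have a0 : a 0%N = - A by rewrite /a mul0r addr0.
have aN : a N = M.
  by rewrite /a /N /s mulrCA divff ?pnatr_eq0// mulr1 addKr.
exists a, N; split => // x y.
(* Rounding moves z upwards only when z < -A, and then to -A <= 0; this is the origin of the terms V
   0. *)
have Vrho z : V (grid_floor a N z) <= V z + V 0.
  apply: (le_trans (V_nd (grid_floor_le a N z))); rewrite a0.
  have := dominating_ge0 z; have := dominating_ge0 0.
  have VA : V (- A) <= V 0 by apply: V_nd; rewrite oppr_le0.
  by case: (leP z (- A)) => zA; lra.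
have [/andP[xin yin]|out] := boolP ((- A < x <= M) && (- A < y <= M)).
  have tb0 : 0 <= 2 * (tail_bound A M x + tail_bound A M y).
    by rewrite mulr_ge0// addr_ge0// tail_bound_ge0.
  have near z : - A < z <= M -> `|z - grid_floor a N z| < h.
    move=> /andP[z1 z2]; have := grid_floor_near (a_nd) aS (x := z) (N := N).
    rewrite a0 aN => /(_ z1 z2)/andP[rl ru].
    by rewrite ger0_norm ?subr_ge0//; lra.
  have := ch x y _ _ _ _ (near x xin) (near y yin).
  move: xin yin => /andP[/ltW x1 x2] /andP[/ltW y1 y2].
  by rewrite x1 x2 y1 y2 => /(_ isT isT); lra.
have tb_out z : ~~ (- A < z <= M) ->
    tail_bound A M z = Num.max (V z + V 0) (V M + V 0).
  by move=> zo; rewrite /tail_bound indicE mem_set ?mulr1//= in_itv/=; exact/negP.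
have tb_in z : - A < z <= M -> V z <= V M by move=> /andP[_ /V_nd].
have diff : `|c x y - c (grid_floor a N x) (grid_floor a N y)| <=
    (V x + V 0) + (V y + V 0).
  have V0 := dominating_ge0 0.
  have := c_ge0 x y; have := c_le x y.
  have := c_ge0 (grid_floor a N x) (grid_floor a N y).
  have := c_le (grid_floor a N x) (grid_floor a N y).
  have := Vrho x; have := Vrho y; rewrite ler_norml => *; apply/andP; split; lra.
apply: (le_trans diff).
have max1 z : V z + V 0 <= Num.max (V z + V 0) (V M + V 0) by rewrite le_max lexx.
have max2 z : V M + V 0 <= Num.max (V z + V 0) (V M + V 0) by rewrite le_max lexx orbT.
have tbx := tail_bound_ge0 A M x; have tby := tail_bound_ge0 A M y.
(* If only y is outside, V x <= V M, so the tail bound at y dominates both V x + V 0 and V y + V 0;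
   hence the factor 2. *)
have [xin|xout] := boolP (- A < x <= M).
  move: out; rewrite xin/= => yout; rewrite (tb_out y yout).
  by have := tb_in x xin; have := max1 y; have := max2 y; lra.
rewrite (tb_out x xout) in tbx *; have [yin|yout] := boolP (- A < y <= M).
  by have := tb_in y yin; have := max1 x; have := max2 x; lra.
by rewrite (tb_out y yout) in tby *; have := max1 x; have := max1 y; lra.
Qed.

(** M is fixed first, by integrability of V; A comes second, since left of -A the bound is a
    constant depending on M. *)
Lemma small_tail_bound (d : measure_display) (S : measurableType d)
    (Q : probability S R) (u v : S -> R) (e : R) : 0 < e ->
  measurable_fun setT u -> measurable_fun setT v ->
  (\int[Q]_s (V (u s))%:E < +oo)%E -> (\int[Q]_s (V (v s))%:E < +oo)%E ->
  exists A M : R, [/\ 0 <= A, 0 <= M,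
    (\int[Q]_s (tail_bound A M (u s))%:E <= e%:E)%E &
    (\int[Q]_s (tail_bound A M (v s))%:E <= e%:E)%E].
Proof.
move=> e0 mu mv Vu Vv; have e20 : 0 < e / 2 by rewrite divr_gt0.
have mVw w : measurable_fun setT w -> measurable_fun setT (fun s : S => V (w s)).
  by move=> mw; exact: measurableT_comp measurable_dominating mw.
have upper w : measurable_fun setT w -> (\int[Q]_s (V (w s))%:E < +oo)%E ->
    \forall n \near \oo, (\int[Q]_s ((V (w s) + V 0) *
      \1_(w @^-1` `](n%:R : R), +oo[%classic) s)%:E <= (e / 2)%:E)%E.
  move=> mw Vw; apply: integral_vanishing_tail => //.
  - by apply: measurable_funD => //; exact: mVw.
  - by move=> s; rewrite addr_ge0 ?dominating_ge0.
  - under eq_integral do rewrite EFinD.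
    rewrite ge0_integralD//; last 3 first.
    + by move=> s _; rewrite lee_fin dominating_ge0.
    + by apply/measurable_EFinP; exact: mVw.
    + by move=> s _; rewrite lee_fin dominating_ge0.
    by rewrite integral_cst//= probability_setT mule1 lte_add_pinfty// ltry.
  - move=> n; rewrite -[X in measurable X]setTI; apply: mw => //.
  - move=> s; exists (Num.truncn `|w s|).+1 => // n /= nw.
    rewrite in_itv/= andbT; apply/negP; rewrite -leNgt.
    apply: (le_trans (ler_norm _)); apply: (le_trans (ltW (truncnS_gt _))).
    by rewrite ler_nat.
have lower w (M : R) : measurable_fun setT w ->
    \forall n \near \oo, (\int[Q]_s ((V M + V 0) *
      \1_(w @^-1` `]-oo, (- n%:R : R)]%classic) s)%:E <= (e / 2)%:E)%E.
  move=> mw; apply: integral_vanishing_tail => //.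
  - by move=> s; rewrite addr_ge0 ?dominating_ge0.
  - by rewrite integral_cst//= probability_setT mule1 ltry.
  - move=> n; rewrite -[X in measurable X]setTI; apply: mw => //.
  - move=> s; exists (Num.truncn `|w s|).+1 => // n /= nw.
    rewrite in_itv/=; apply/negP; rewrite -ltNge ltrNl.
    apply: (le_lt_trans (ler_norm _)); rewrite normrN.
    by apply: (lt_le_trans (truncnS_gt _)); rewrite ler_nat.
have [m [mu1 mv1]] := filter_ex (filterI (upper u mu Vu) (upper v mv Vv)).
have [k [ku kv]] := filter_ex (filterI (lower u m%:R mu) (lower v m%:R mv)).
(* The maximum in [tail_bound] is its first argument right of m and its second left of -k, so the
   two tail integrals suffice. *)
have tail_le w : measurable_fun setT w ->
    (\int[Q]_s ((V (w s) + V 0) *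
      \1_(w @^-1` `](m%:R : R), +oo[%classic) s)%:E <= (e / 2)%:E)%E ->
    (\int[Q]_s ((V m%:R + V 0) *
      \1_(w @^-1` `]-oo, (- k%:R : R)]%classic) s)%:E <= (e / 2)%:E)%E ->
    (\int[Q]_s (tail_bound k%:R m%:R (w s))%:E <= e%:E)%E.
  move=> mw up low; rewrite (splitr e) EFinD.
  apply: le_trans (leeD up low).
  have mray B : measurable B -> measurable (w @^-1` B).
    by move=> mB; rewrite -[X in measurable X]setTI; exact: mw.
  have m1 : measurable_fun setT (fun s => ((V (w s) + V 0) *
      \1_(w @^-1` `](m%:R : R), +oo[%classic) s)%:E).
    apply/measurable_EFinP; apply: measurable_funM.
      by apply: measurable_funD => //; exact: mVw.
    by apply: measurable_indic; apply: mray; exact: measurable_itv.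
  have m2 : measurable_fun setT (fun s => ((V m%:R + V 0) *
      \1_(w @^-1` `]-oo, (- k%:R : R)]%classic) s)%:E).
    apply/measurable_EFinP; apply: measurable_funM => //.
    by apply: measurable_indic; apply: mray; exact: measurable_itv.
  have p1 s : [set: S] s -> (0 <= ((V (w s) + V 0) *
      \1_(w @^-1` `](m%:R : R), +oo[%classic) s)%:E)%E.
    by move=> _; rewrite lee_fin mulr_ge0// addr_ge0// dominating_ge0.
  have p2 s : [set: S] s -> (0 <= ((V m%:R + V 0) *
      \1_(w @^-1` `]-oo, (- k%:R : R)]%classic) s)%:E)%E.
    by move=> _; rewrite lee_fin mulr_ge0// addr_ge0// dominating_ge0.
  rewrite -ge0_integralD//; apply: ge0_le_integral => //.
  - by move=> s _; rewrite lee_fin tail_bound_ge0.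
  - by apply/measurable_EFinP; apply: measurableT_comp mw; exact: measurable_tail_bound.
  - exact: emeasurable_funD.
  - move=> s sT; have := p1 s sT; have := p2 s sT.
    rewrite -EFinD !lee_fin /tail_bound.
    rewrite !indicE; have [wm|wm] := leP (w s) m%:R; last first.
      have Vmw : V m%:R <= V (w s) by apply: V_nd; exact: ltW.
      rewrite [_ \in w @^-1` `]m%:R, +oo[%classic]mem_set/= ?in_itv/= ?wm//.
      rewrite max_l; last by rewrite lerD2r.
      have := dominating_ge0 (w s); have := dominating_ge0 0 => V0 Vw.
      move=> p2' _; have : (V (w s) + V 0) * (w s \in ~` `]-k%:R, m%:R]%classic)%:R
        <= V (w s) + V 0.
        by case: (_ \in _); rewrite ?mulr1 ?mulr0// addr_ge0.
      by lra.
    have [wk|wk] := leP (w s) (- k%:R).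
      rewrite [_ \in w @^-1` `]-oo, _]%classic]mem_set/= ?in_itv/= ?wk//.
      have -> : (w s \in ~` `]- k%:R, m%:R]%classic) = true.
        by apply: mem_set => /=; rewrite in_itv/= => /andP[]; rewrite ltNge wk.
      by rewrite max_r ?lerD2r ?V_nd// => _ p; rewrite lerDr.
    have -> : (w s \in ~` `]- k%:R, m%:R]%classic) = false.
      by apply: memNset => /=; apply; rewrite in_itv/= wk wm.
    by rewrite mulr0 => *; exact: addr_ge0.
by exists k%:R, m%:R; split => //; [exact: tail_le mu mu1 ku|exact: tail_le mv mv1 kv].
Qed.

End Approximation.

(** * Two-sided bounds on the Wasserstein cost *)

Section GridBounds.
Context (R : realType) (c : R -> R -> R) (a : nat -> R) (N : nat)
  (tau : R -> R) (e : R).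
Hypotheses (c_good : good_cost c)
  (c_meas : measurable_fun setT (fun z : R * R => c z.1 z.2))
  (c_ge0 : forall x y : R, 0 <= c x y)
  (a_nd : {homo a : i j / (i <= j)%N >-> i <= j})
  (e0 : 0 <= e) (mtau : measurable_fun setT tau) (tau0 : forall x, 0 <= tau x)
  (c_close : forall x y, `|c x y - c (grid_floor a N x) (grid_floor a N y)| <=
      e + 2 * (tau x + tau y)).

(** Two additive inequalities instead of a distance: E c(X, Y) is not known to be finite here. *)
Lemma expectation_grid_close (d : measure_display) (T : measurableType d)
    (P : probability T R) (X Y : {RV P >-> R}) (E1 E2 : R) :
  (\int[P]_t (tau (X t))%:E = E1%:E)%E -> (\int[P]_t (tau (Y t))%:E = E2%:E)%E ->
  let K := (e + 2 * (E1 + E2))%:E in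
  (\int[P]_t (c (X t) (Y t))%:E <=
     \int[P]_t (c (grid_floor a N (X t)) (grid_floor a N (Y t)))%:E + K)%E /\
  (\int[P]_t (c (grid_floor a N (X t)) (grid_floor a N (Y t)))%:E <=
     \int[P]_t (c (X t) (Y t))%:E + K)%E.
Proof.
move=> EX EY K.
pose k t := e + 2 * (tau (X t) + tau (Y t)).
have mX : measurable_fun setT (fun t => tau (X t)) by exact: measurableT_comp.
have mY : measurable_fun setT (fun t => tau (Y t)) by exact: measurableT_comp.
have mk : measurable_fun setT k.
  by apply: measurable_funD => //; apply: measurable_funM => //; exact: measurable_funD.
have k0 t : 0 <= k t by rewrite addr_ge0// mulr_ge0// addr_ge0.
have mXE : measurable_fun setT (fun t => (tau (X t))%:E) by exact/measurable_EFinP.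
have mYE : measurable_fun setT (fun t => (tau (Y t))%:E) by exact/measurable_EFinP.
have X0 t : [set: T] t -> (0 <= (tau (X t))%:E)%E by rewrite lee_fin.
have Y0 t : [set: T] t -> (0 <= (tau (Y t))%:E)%E by rewrite lee_fin.
have Ek : (\int[P]_t (k t)%:E = K)%E.
  transitivity (\int[P]_t (e%:E + 2%:E * ((tau (X t))%:E + (tau (Y t))%:E)))%E.
    exact: eq_integral.
  rewrite ge0_integralD//; last 2 first.
  - move=> t tT; apply: mule_ge0; first by rewrite lee_fin.
    exact: adde_ge0 (X0 t tT) (Y0 t tT).
  - by apply: measurable_funeM; exact: emeasurable_funD.
  rewrite ge0_integralZl_EFin//; last 2 first.
  - by move=> t tT; exact: adde_ge0 (X0 t tT) (Y0 t tT).
  - exact: emeasurable_funD.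
  by rewrite ge0_integralD// EX EY integral_cst//= probability_setT mule1.
have mc : measurable_fun setT (fun t => c (X t) (Y t)).
  have mXY : measurable_fun setT (fun t => (X t, Y t)) by exact: measurable_fun_pair.
  exact: measurableT_comp c_meas mXY.
have mg : measurable_fun setT
    (fun t => c (grid_floor a N (X t)) (grid_floor a N (Y t))).
  exact: measurable_grid_floor_cost.
by split; apply: (integral_le_perturbation (k := k)) => // t;
  have := c_close (X t) (Y t); rewrite /k ler_norml => /andP[]; lra.
Qed.

(** The lower bound holds for each coupling with the same error, since E1 and E2 depend on the
    marginals only; the upper bound comes from the quantile coupling. *)
Lemma wasserstein_grid_bounds (Q : probability (R * R)%type R) (F G : R -> R)
    (E1 E2 : R) : marginal_cdfs Q F G ->
  (\int[Q]_z (tau z.1)%:E = E1%:E)%E -> (\int[Q]_z (tau z.2)%:E = E2%:E)%E ->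
  ((grid_cost a N c F G - (e + 2 * (E1 + E2)))%:E <= wasserstein_cost c F G)%E /\
  (wasserstein_cost c F G <= (grid_cost a N c F G + (e + 2 * (E1 + E2)))%:E)%E.
Proof.
move=> [QF QG] EX EY.
pose X : {RV Q >-> R} := HB.pack (fst : R * R -> R)
  (isMeasurableFun.Build _ _ _ _ (fst : R * R -> R) measurable_fst).
pose Y : {RV Q >-> R} := HB.pack (snd : R * R -> R)
  (isMeasurableFun.Build _ _ _ _ (snd : R * R -> R) measurable_snd).
have XF : has_cdf X F.
  move=> r; rewrite -QF /cdf /distribution /= /pushforward; congr (Q _).
  by apply/seteqP; split => z /= => [|[]].
have YG : has_cdf Y G.
  move=> r; rewrite -QG /cdf /distribution /= /pushforward; congr (Q _).
  by apply/seteqP; split => z /= => [|[]].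
have tauE : measurable_fun setT (fun x => (tau x)%:E) by exact/measurable_EFinP.
have tau0E x : (0 <= (tau x)%:E)%E by rewrite lee_fin.
split.
  apply: le_ereal_inf_tmp => _ [d [T [P [X' [Y' [XF' YG' ->]]]]]].
  have EX' := etrans (has_cdf_integral XF' XF tauE tau0E) EX.
  have EY' := etrans (has_cdf_integral YG' YG tauE tau0E) EY.
  have [_ close] := expectation_grid_close EX' EY'.
  rewrite EFinB leeBlDr// unlock; apply: le_trans close.
  exact: grid_cost_le.
have [X' [Y' [XF' YG' XY]]] := comonotone_coupling XF YG.
have EX' := etrans (has_cdf_integral XF' XF tauE tau0E) EX.
have EY' := etrans (has_cdf_integral YG' YG tauE tau0E) EY.
have [close _] := expectation_grid_close EX' EY'.
rewrite (grid_cost_comonotone a_nd N c XF' YG' XY) in close.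
apply: le_trans close.
apply: ereal_inf_lbound.
by eexists _, _, _, X', Y'; split => //; rewrite unlock.
Qed.

End GridBounds.

Section EmpiricalCdf.
Context (R : realType).

Lemma empirical_marginal_cdfs (z : nat -> R * R) (n : nat)
    (Q : probability (R * R)%type R) :
  (forall f : R * R -> R, measurable_fun setT f -> (forall s, 0 <= f s) ->
    (\int[Q]_s (f s)%:E = ((\sum_(i < n) f (z i)) / n%:R)%:E)%E) ->
  marginal_cdfs Q (empirical_cdf (fun i => (z i).1) n)
    (empirical_cdf (fun i => (z i).2) n).
Proof.
move=> Qf; split => r.
  have mA : measurable (`]-oo, r]%classic `*` [set: R]).
    by apply: measurableX => //; exact: measurable_itv.
  have := Qf _ (measurable_indic mA) (fun s => _).
  rewrite integral_indic// setIT => ->.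
  - congr ((_ / _)%:E); apply: eq_bigr => i _.
    by rewrite indicE in_setX/= in_setT andbT mem_setE in_itv.
  - by move=> s.
have mA : measurable ([set: R] `*` `]-oo, r]%classic).
  by apply: measurableX => //; exact: measurable_itv.
have := Qf _ (measurable_indic mA) (fun s => _).
rewrite integral_indic// setIT => ->.
- congr ((_ / _)%:E); apply: eq_bigr => i _.
  by rewrite indicE in_setX/= in_setT mem_setE in_itv.
- by move=> s.
Qed.

End EmpiricalCdf.

(** * Almost sure convergence *)

Theorem theorem12 (R : realType) (d : measure_display) (T : measurableType d)
    (P : probability T R)
    (Z : nat -> {RV P >-> (R * R)%type}) (Pi : probability (R * R)%type R)
    (F G : R -> R) (c : R -> R -> R) (V : R -> R)
    (Z_iid : iid_with_law Z Pi) (Pi_FG : marginal_cdfs Pi F G)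
    (c_good : good_cost c)
    (c_cont : continuous (fun z : R * R => c z.1 z.2))
    (F_cont : continuous F) (G_cont : continuous G)
    (F_incr : {homo F : x y / x < y}) (G_incr : {homo G : x y / x < y})
    (c_ge0 : forall x y : R, 0 <= c x y)
    (c_le : forall x y : R, c x y <= V x + V y)
    (V_incr : {homo V : x y / x < y})
    (V_F : ('E_Pi[fun z => V z.1] < +oo)%E)
    (V_G : ('E_Pi[fun z => V z.2] < +oo)%E) :
  {ae P, forall t : T,
     (wasserstein_cost c (empirical_cdf (fun i => (Z i t).1) n)
                         (empirical_cdf (fun i => (Z i t).2) n)
        @[n --> \oo] --> wasserstein_cost c F G)}
  /\ (wasserstein_cost c F G < +oo)%E.
Proof.
have V_nd : {homo V : x y / x <= y} by exact: ltW_homo.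
have mV := measurable_dominating V_nd.
have mc := measurable_cost c_cont.
rewrite unlock in V_F; rewrite unlock in V_G.
have mfst : measurable_fun setT (fst : R * R -> R) by exact: measurable_fst.
have msnd : measurable_fun setT (snd : R * R -> R) by exact: measurable_snd.
have close (e : R) : 0 < e -> exists a N (tau : R -> R) (E1 E2 : R),
    [/\ {homo a : i j / (i <= j)%N >-> i <= j}, measurable_fun setT tau,
      forall x, 0 <= tau x,
      forall x y, `|c x y - c (grid_floor a N x) (grid_floor a N y)| <=
        e + 2 * (tau x + tau y) &
      [/\ (\int[Pi]_z (tau z.1)%:E = E1%:E)%E,
        (\int[Pi]_z (tau z.2)%:E = E2%:E)%E, E1 <= e & E2 <= e]].
  move=> e0.
  have [A [M [A0 M0 tail1 tail2]]] :=
    small_tail_bound c_ge0 c_le V_nd e0 mfst msnd V_F V_G.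
  have [a [N [a_nd c_close]]] :=
    cost_grid_approximation c_cont c_ge0 c_le V_nd A0 M0 e0.
  have fin (w : R * R -> R) :
      (\int[Pi]_z (tail_bound V A M (w z))%:E <= e%:E)%E ->
      exists2 E, (\int[Pi]_z (tail_bound V A M (w z))%:E = E%:E)%E & E <= e.
    move=> le; have nn : (0 <= \int[Pi]_z (tail_bound V A M (w z))%:E)%E.
      by apply: integral_ge0 => z _; rewrite lee_fin (tail_bound_ge0 c_ge0 c_le).
    have f : (\int[Pi]_z (tail_bound V A M (w z))%:E)%E \is a fin_num.
      by rewrite ge0_fin_numE// (le_lt_trans le)// ltry.
    by exists (fine (\int[Pi]_z (tail_bound V A M (w z))%:E)%E);
      rewrite ?fineK// -lee_fin fineK.
  have [E1 E1E E1e] := fin _ tail1; have [E2 E2E E2e] := fin _ tail2.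
  exists a, N, (tail_bound V A M), E1, E2; split => //.
  - exact: measurable_tail_bound.
  - exact: tail_bound_ge0.
have fin_between (x : \bar R) (l u : R) :
    (l%:E <= x <= u%:E)%E -> x \is a fin_num.
  move=> /andP[lx xu].
  by rewrite fin_real// (lt_le_trans (ltNyr l) lx) (le_lt_trans xu (ltry u)).
have [w wE] : exists w, wasserstein_cost c F G = w%:E.
  have [a [N [tau [E1 [E2 [a_nd mtau tau0 c_close [E1E E2E _ _]]]]]]] :=
    close 1 ltr01.
  have [lo up] := wasserstein_grid_bounds c_good mc c_ge0 a_nd ler01 mtau tau0
    c_close Pi_FG E1E E2E.
  exists (fine (wasserstein_cost c F G)); rewrite fineK//.
  by apply: fin_between; apply/andP; split; [exact: lo|exact: up].
split; last by rewrite wE ltry.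
pose W n (t : T) := wasserstein_cost c (empirical_cdf (fun i => (Z i t).1) n)
  (empirical_cdf (fun i => (Z i t).2) n).
(* The null set may depend on e: only the countably many values 1 / (k + 1) are used. *)
suff near_W (e : R) : 0 < e -> {ae P, forall t, \forall n \near \oo,
    ((w - e)%:E <= W n t <= (w + e)%:E)%E}.
  have : {ae P, forall t (k : nat), \forall n \near \oo,
      ((w - k.+1%:R^-1)%:E <= W n t <= (w + k.+1%:R^-1)%:E)%E}.
    by apply: ae_foralln => k; apply: near_W; rewrite invr_gt0.
  apply: filterS => t Ht; rewrite wE; apply/fine_cvgP; split.
    by apply: filterS (Ht 0%N) => n; exact: fin_between.
  apply/cvgrPdist_le => e e0.
  have [k _ Hk] := near_infty_natSinv_lt (PosNum e0).
  have {}Hk : k.+1%:R^-1 < e := Hk k (leqnn k).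
  apply: filterS (Ht k) => n lu.
  have := lu; rewrite -{1 2}(fineK (fin_between _ _ _ lu)) !lee_fin => /andP[lo up].
  rewrite ler_distlC /= -/(W n t).
  by move: (k.+1%:R^-1) Hk lo up => r *; apply/andP; split; lra.
(* With d = e / 16, the rounding error is at most d + 2 (d + d) = 5 d for (F, G) and d + 2 (2 d + 2
   d) = 9 d for the empirical pair; the grid costs differ by at most d, so 15 d in total. *)
move=> e0; have e16 : 0 < e / 16 by rewrite divr_gt0.
have [a [N [tau [E1 [E2 [a_nd mtau tau0 c_close [E1E E2E E1e E2e]]]]]]] :=
  close _ e16.
have mt1 : measurable_fun setT (fun z : R * R => tau z.1) by exact: measurableT_comp.
have mt2 : measurable_fun setT (fun z : R * R => tau z.2) by exact: measurableT_comp.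
have tau1 := upper_lln Z_iid e16 mt1 (fun z => tau0 z.1) E1E.
have tau2 := upper_lln Z_iid e16 mt2 (fun z => tau0 z.2) E2E.
have cdf1 : {ae P, forall t i,
    empirical_cdf (fun i => (Z i t).1) n (a i) @[n --> \oo] --> F (a i)}.
  apply: ae_foralln => i.
  have mA : measurable (`]-oo, a i]%classic `*` [set: R]).
    by apply: measurableX => //; exact: measurable_itv.
  apply: filterS (empirical_frequency_cvg Z_iid mA) => t.
  rewrite Pi_FG.1 /=; set u := (u in u @ _ --> _) => freq.
  have -> : (fun n => empirical_cdf (fun j => (Z j t).1) n (a i)) = u => //.
  apply/funext => n; congr (_ / _); apply: eq_bigr => j _.
  by rewrite indicE in_setX/= in_setT andbT mem_setE in_itv.
have cdf2 : {ae P, forall t i,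
    empirical_cdf (fun i => (Z i t).2) n (a i) @[n --> \oo] --> G (a i)}.
  apply: ae_foralln => i.
  have mA : measurable ([set: R] `*` `]-oo, a i]%classic).
    by apply: measurableX => //; exact: measurable_itv.
  apply: filterS (empirical_frequency_cvg Z_iid mA) => t.
  rewrite Pi_FG.2 /=; set u := (u in u @ _ --> _) => freq.
  have -> : (fun n => empirical_cdf (fun j => (Z j t).2) n (a i)) = u => //.
  apply/funext => n; congr (_ / _); apply: eq_bigr => j _.
  by rewrite indicE in_setX/= in_setT mem_setE in_itv.
have [lo up] := wasserstein_grid_bounds c_good mc c_ge0 a_nd (ltW e16) mtau tau0
  c_close Pi_FG E1E E2E.
rewrite wE !lee_fin in lo up.
apply: filterS2 (filterI tau1 tau2) (filterI cdf1 cdf2) => t [t1 t2] [c1 c2].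
have cost_cvg := grid_cost_cvg (N := N) (c := c) c1 c2.
have /cvgrPdist_le/(_ _ e16) cost_near := cost_cvg.
(* For n = 0 the empirical functions vanish and are not c.d.f.s. *)
have n_near : \forall n \near \oo, (0 < n)%N by exact: nbhs_infty_gt.
apply: filterS2 (filterI t1 t2) (filterI cost_near n_near) => n [T1 T2] [Cn n0].
have nR0 : 0 < n%:R :> R by rewrite ltr0n.
have [Q QE] := empirical_law R (fun i => Z i t) n0.
have QFG := empirical_marginal_cdfs (z := fun i => Z i t) QE.
(* The same grid and tau now serve the empirical pair, with sample means of tau as E1 and E2. *)
have [nlo nup] := wasserstein_grid_bounds c_good mc c_ge0 a_nd (ltW e16) mtau tau0
  c_close QFG (QE _ mt1 (fun z => tau0 z.1)) (QE _ mt2 (fun z => tau0 z.2)).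
have {}T1 : (\sum_(i < n) tau (Z i t).1) / n%:R <= E1 + e / 16.
  by rewrite ler_pdivrMr// mulrC.
have {}T2 : (\sum_(i < n) tau (Z i t).2) / n%:R <= E2 + e / 16.
  by rewrite ler_pdivrMr// mulrC.
move: Cn; rewrite ler_norml => /andP[C1 C2].
apply/andP; split.
  by apply: le_trans nlo; rewrite lee_fin; lra.
by apply: (le_trans nup); rewrite lee_fin; lra.
Qed.
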